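(* Let $K$ be a field, let $\mathcal{M}$ be a monoidal complex supported on a conical complex $\Sigma$, let $(a_e)_{e\in E}$ be a (finite) family of elements of $|\mathcal{M}|$ such that $\{a_e:e\in E\}\cap M_c$ generates $M_c$ for each $c\in\Sigma$, and let $w=(w_e)_{e\in E}$ be a weight vector. Let $\mathcal{M}_w$ be the monoidal complex defined by $w$. Then the ideal $J_{\mathcal{M}_w}$ is the radical of the initial ideal $\operatorname{in}_w(I_{\mathcal{M}})$.
   Context: A cone is a set $\mathbb{R}_+x_1+\dots+\mathbb{R}_+x_n\subseteq\mathbb{R}^d$. Its faces are $C$ itself and the sets $C\cap H$ with $H$ a linear hyperplane having $C$ in one of its closed halfspaces. An isomorphism of cones is a bijection extending to an isomorphism of their linear spans. A conical complex $\Sigma$ consists of a finite set $\Sigma$ of sets, for each $c\in\Sigma$ a cone $C_c\subseteq\mathbb{R}^{\delta_c}$ with $\delta_c=\dim\mathbb{R}C_c$, and a bijection $\pi_c:C_c\to c$ such that: (a) for each face $C'$ of $C_c$ there is $c'\in\Sigma$ with $\pi_c(C')=c'$; (b) for all $c,d\in\Sigma$ there are faces $C'$ of $C_c$ and $D'$ of $C_d$ with $c\cap d=\pi_c(C')=\pi_d(D')$ such that $\pi_d^{-1}\circ\pi_c$ restricts to an isomorphism of cones $C'\to D'$. The elements of $\Sigma$ are its faces, the maximal ones its facets; $|\Sigma|=\bigcup_{c\in\Sigma}c$, and $C_c$ is identified with $c\subseteq|\Sigma|$. A monoidal complex $\mathcal{M}=(M_c)_{c\in\Sigma}$ supported by $\Sigma$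 consists of finitely generated monoids $M_c\subseteq C_c\cap\mathbb{Z}^{\delta_c}$ with $\mathbb{R}_+M_c=C_c$ such that $\pi_d^{-1}\circ\pi_c$ restricts to a monoid isomorphism $M_c\cap\pi_c^{-1}(c\cap d)\to M_d\cap\pi_d^{-1}(c\cap d)$ for all $c,d\in\Sigma$. Put $|\mathcal{M}|=\varinjlim M_c$ (the union of the $M_c$ inside $|\Sigma|$). The toric face ring $K[\mathcal{M}]$ has $K$-basis $t^a$, $a\in|\mathcal{M}|$, with $t^at^b=t^{a+b}$ if $a,b\in M_c$ for some $c\in\Sigma$, and $t^at^b=0$ otherwise. Let $S=K[X_e:e\in E]$ and let $I_{\mathcal{M}}$ be the kernel of $S\to K[\mathcal{M}]$, $X_e\mapsto t^{a_e}$. A weight vector is $w\in\mathbb{N}^E$ ($\mathbb{N}$ the non-negative integers); $X_e$ gets weight $w_e$. The initial component $\operatorname{in}_w(f)$ is the $w$-homogeneous component of $f$ of highest $w$-degree, and $\operatorname{in}_w(I)$ is the ideal generated by all $\operatorname{in}_w(f)$, $f\in I$. Complex $\Gamma_w$: for $c\in\Sigma$ let $C'_c\subseteq\mathbb{R}^{\delta_c+1}$ be the cone generated by all $(a_e,w_e)$ with $a_e\in C_c$. For $a\in|\Sigma|$ let $c$ be the minimal face of $\Sigma$ containing $a$ and put $\operatorname{ht}_w(a)=\min\{h'\in\mathbb{R}:(a,h')\in C'_c\}$. The bottom of $C'_c$ is the set of $(a,h_a)\in C'_c$ with $h_a=\min\{h':(a,h')\in C'_c\}$; it is a union of faces of $C'_c$.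 The projections to $C_c$ of the faces of $C'_c$ contained in the bottom form a conical subdivision of $C_c$, and together, for all $c\in\Sigma$, these form a conical complex $\Gamma_w$ with $|\Gamma_w|=|\Sigma|$. Write $D_d$ for the cone of $d\in\Gamma_w$. Monoidal complex $\mathcal{M}_w$: for $d\in\Gamma_w$ let $N_{d,w}$ be the monoid generated by all $a_e\in D_d$ with $\operatorname{ht}_w(a_e)=w_e$. The cones $D_d$ and monoids $N_{d,w}$ form a monoidal complex $\mathcal{M}_w$ supported by $\Gamma_w$, the monoidal complex defined by $w$. The ideal $J_{\mathcal{M}_w}$ is the kernel of the surjection $S\to K[\mathcal{M}_w]$ with $X_e\mapsto t^{a_e}$ if $\operatorname{ht}_w(a_e)=w_e$, and $X_e\mapsto 0$ otherwise. *)

(* Defs.v *)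
From HB Require Import structures.
From mathcomp Require Import all_boot all_order all_algebra.
From mathcomp Require Import finmap.
From mathcomp Require Import -(notations) monalg.
From mathcomp Require Import mpoly.
From mathcomp Require Import boolp classical_sets functions cardinality reals.

Set Implicit Arguments.
Unset Strict Implicit.
Unset Printing Implicit Defensive.

Import Order.TTheory GRing.Theory Num.Theory.

Local Open Scope classical_set_scope.
Local Open Scope ring_scope.

Section Hulls.
Context {R : realType} {n : nat}.
Implicit Types A C F G : set 'rV[R]_n.

Definition cone_hull A : set 'rV[R]_n :=
  [set v | exists2 s : seq (R * 'rV[R]_n),
     (forall p, p \in s -> 0 <= p.1 /\ A p.2) &
     v = \sum_(p <- s) p.1 *: p.2].

Definition lin_span A : set 'rV[R]_n :=
  [set v | exists2 s : seq (R * 'rV[R]_n),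
     (forall p, p \in s -> A p.2) & v = \sum_(p <- s) p.1 *: p.2].

Definition monoid_hull A : set 'rV[R]_n :=
  [set v | exists2 s : seq 'rV[R]_n,
     (forall x, x \in s -> A x) & v = \sum_(x <- s) x].

(* The linear span of the cone is the span of its generators s. *)
Definition full_dim_cone C :=
  exists2 s : seq 'rV[R]_n, C = cone_hull [set` s] & \dim <<s>>%VS = n.

Definition dotv (v : 'rV[R]_n) (u : 'cV[R]_n) : R := (v *m u) 0 0.

Definition is_face C F :=
  F = C \/ exists u : 'cV[R]_n,
    [/\ u != 0, forall v, C v -> 0 <= dotv v u &
        F = C `&` [set v | dotv v u = 0]].

Lemma dotvD x y u : dotv (x + y) u = dotv x u + dotv y u.
Proof. by rewrite /dotv mulmxDl mxE. Qed.

Lemma dotvZ r x u : dotv (r *: x) u = r * dotv x u.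
Proof. by rewrite /dotv -scalemxAl mxE. Qed.

Lemma dotv0l u : dotv 0 u = 0.
Proof. by rewrite /dotv mul0mx mxE. Qed.

Lemma dotv0r x : dotv x 0 = 0.
Proof. by rewrite /dotv mulmx0 mxE. Qed.

Lemma dotvDr x u u' : dotv x (u + u') = dotv x u + dotv x u'.
Proof. by rewrite /dotv mulmxDr mxE. Qed.

Lemma dotvZr r x u : dotv x (r *: u) = r * dotv x u.
Proof. by rewrite /dotv -scalemxAr mxE. Qed.

Lemma faceP C F : is_face C F <->
  exists2 u : 'cV[R]_n, (forall v, C v -> 0 <= dotv v u) &
        F = C `&` [set v | dotv v u = 0].
Proof.
have C0 : C = C `&` [set v | dotv v 0 = 0].
  by rewrite setIidl// => v _ /=; rewrite dotv0r.
split=> [[->|[u [_ u0 ->]]]|[u u0 ->]]; [|by exists u|].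
  by exists 0 => // v _; rewrite dotv0r.
have [->|un0] := eqVneq u 0; [left; exact/esym|by right; exists u].
Qed.

Lemma face_sub C F : is_face C F -> F `<=` C.
Proof. by move=> [->|[u [_ _ ->]]] // v []. Qed.

Lemma cone_hull0 A : cone_hull A 0.
Proof. by exists [::]; rewrite ?big_nil. Qed.

Lemma cone_hullD A x y : cone_hull A x -> cone_hull A y -> cone_hull A (x + y).
Proof.
move=> [s sA ->] [t tA ->]; exists (s ++ t); last by rewrite big_cat.
by move=> p; rewrite mem_cat => /orP[/sA|/tA].
Qed.

Lemma cone_hullZ A r x : 0 <= r -> cone_hull A x -> cone_hull A (r *: x).
Proof.
move=> r0 [s sA ->]; exists [seq (r * p.1, p.2) | p <- s].
  by move=> p /mapP[q /sA[q0 qA] ->]; split=> //=; rewrite mulr_ge0.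
by rewrite big_map scaler_sumr; apply: eq_bigr => p _; rewrite scalerA.
Qed.

Lemma sub_cone_hull A : A `<=` cone_hull A.
Proof.
move=> x Ax; exists [:: (1, x)]; last by rewrite big_seq1 scale1r.
by move=> p; rewrite inE => /eqP->.
Qed.

Lemma cone_ind A (P : 'rV[R]_n -> Prop) : P 0 ->
  (forall r x v, 0 <= r -> A x -> cone_hull A v -> P v -> P (r *: x + v)) ->
  forall v, cone_hull A v -> P v.
Proof.
move=> P0 PD v [s sA ->]; suff [] : P (\sum_(p <- s) p.1 *: p.2) /\
  cone_hull A (\sum_(p <- s) p.1 *: p.2) by [].
elim: s sA => [|p s IH] sA; first by rewrite big_nil; split=> //; exact: cone_hull0.
have [p0 pA] := sA p (mem_head _ _).
have [|Ps Cs] := IH; first by move=> q qs; apply: sA; rewrite inE qs orbT.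
rewrite big_cons; split; first exact: PD.
by apply: cone_hullD => //; apply: cone_hullZ => //; exact: sub_cone_hull.
Qed.

Lemma cone_hull_min A C : C 0 -> (forall x y, C x -> C y -> C (x + y)) ->
  (forall r x, 0 <= r -> C x -> C (r *: x)) -> A `<=` C -> cone_hull A `<=` C.
Proof.
move=> C0 CD CZ AC; apply: cone_ind => // r x v r0 Ax _ Cv.
by apply: CD => //; apply: CZ => //; exact: AC.
Qed.

Lemma cone_hull_sub A B : A `<=` cone_hull B -> cone_hull A `<=` cone_hull B.
Proof.
by apply: cone_hull_min; [exact: cone_hull0|exact: cone_hullD|move=> *; exact: cone_hullZ].
Qed.

Lemma face_hull A F : is_face (cone_hull A) F -> F = cone_hull (A `&` F).
Proof.
move=> fF; apply/seteqP; split; last first.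
  have [u u0 FE] := (faceP _ _).1 fF.
  apply: cone_hull_min; last by move=> x [].
  - by rewrite FE; split; [exact: cone_hull0|exact: dotv0l].
  - rewrite FE => x y [Cx /= x0] [Cy /= y0]; split; first exact: cone_hullD.
    by rewrite /= dotvD x0 y0 addr0.
  - rewrite FE => r x r0 [Cx /= x0]; split; first exact: cone_hullZ.
    by rewrite /= dotvZ x0 mulr0.
have [u u0 FE] := (faceP _ _).1 fF; rewrite {1}FE => v [Cv].
move: v Cv; apply: cone_ind => [_|r x v r0 Ax Cv IH]; first exact: cone_hull0.
have Cx := sub_cone_hull Ax.
rewrite /= dotvD dotvZ => /eqP.
rewrite paddr_eq0 ?mulr_ge0 ?u0// mulf_eq0 => /andP[/orP[/eqP->|/eqP x0] /eqP v0].
  by rewrite scale0r add0r; exact: IH.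
apply: cone_hullD; last exact: IH.
by apply: cone_hullZ => //; apply: sub_cone_hull; split=> //; rewrite FE.
Qed.

Lemma face_extremal C F x y : is_face C F -> C x -> C y -> F (x + y) -> F x.
Proof.
move=> /faceP[u u0 ->] Cx Cy [_ /=]; rewrite dotvD => /eqP.
by rewrite paddr_eq0 ?u0// => /andP[/eqP]; split.
Qed.

Lemma face_hull_trans A F G : finite_set A ->
  is_face (cone_hull A) F -> is_face F G -> is_face (cone_hull A) G.
Proof.
move=> /finite_seqP[s ->] fF fG.
have [u u0 FE] := (faceP _ _).1 fF; have [u' u'0 GE] := (faceP _ _).1 fG.
have [N [N0 NP]] : exists N : R, 0 <= N /\
    forall x, x \in s -> 0 < dotv x u -> 0 < N * dotv x u + dotv x u'.
  elim: s {fF FE u0} => [|x s [N [N0 NP]]]; first by exists 0.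
  pose M := (`|dotv x u'| + 1) / dotv x u.
  have [xu|xu] := ltP 0 (dotv x u); last first.
    exists N; split=> // y; rewrite inE => /orP[/eqP->|/NP//].
    by rewrite ltNge xu.
  have M0 : 0 <= M by rewrite divr_ge0 ?addr_ge0// ltW.
  exists (N + M); split=> [|y]; first exact: addr_ge0.
  rewrite inE mulrDl => /orP[/eqP->|ys] yu.
    rewrite divfK ?gt_eqF// -!addrA ltr_wpDl ?mulr_ge0 ?(ltW yu)//.
    rewrite addrCA ltr_wpDr// -lerBlDr sub0r.
    by rewrite -normrN ler_norm.
  by rewrite addrAC ltr_wpDr ?NP// mulr_ge0// ltW.
have ge v : cone_hull [set` s] v -> 0 <= dotv v (N *: u + u').
  move: v; apply: cone_ind => [|r x v r0 xs Cv IH]; first by rewrite dotv0l.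
  rewrite dotvD dotvZ addr_ge0// mulr_ge0// dotvDr dotvZr.
  have := u0 x (sub_cone_hull xs); rewrite le_eqVlt => /orP[/eqP xu|/NP].
    rewrite -xu mulr0 add0r u'0// FE; split=> //; first exact: sub_cone_hull.
  by move=> /(_ xs)/ltW.
apply/faceP; exists (N *: u + u'); first exact: ge.
apply/seteqP; split=> v; rewrite /= dotvDr dotvZr.
  by rewrite GE FE => -[[Cv /= ->] /= ->]; rewrite mulr0 addr0.
move=> [Cv]; rewrite GE => v0; suff : F v.
  by move=> Fv; split=> //; move: Fv v0; rewrite FE => -[_ /= ->]; rewrite mulr0 add0r.
move: v Cv v0; apply: cone_ind => [_|r x v r0 xs Cv IH].
  by rewrite FE; split; [exact: cone_hull0|exact: dotv0l].
have Cx := sub_cone_hull xs.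
rewrite -dotvZr -dotvDr dotvD dotvZ => /eqP.
rewrite paddr_eq0 ?ge ?mulr_ge0 ?ge// mulf_eq0 => /andP[rx /eqP v0].
have Fv : F v by apply: IH; rewrite -dotvZr -dotvDr.
case/orP: rx => [/eqP->|/eqP x0]; first by rewrite scale0r add0r.
have Fx : F x.
  rewrite FE; split=> //=; have := u0 x Cx; rewrite le_eqVlt => /orP[/eqP//|].
  by move=> /(NP _ xs); rewrite -dotvZr -dotvDr x0 ltxx.
move: Fx Fv; rewrite FE => -[_ /= xu] [_ /= vu]; split.
  by apply: cone_hullD => //; exact: cone_hullZ.
by rewrite /= dotvD dotvZ xu vu mulr0 addr0.
Qed.

Lemma finite_faces A : finite_set A -> finite_set (is_face (cone_hull A)).
Proof.
move=> /finite_seqP[s ->].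
apply: (@sub_finite_set _ _
  ((fun B : {set seq_sub s} => cone_hull [set x | exists2 y, y \in B & x = val y])
    @` [set: {set seq_sub s}])); last by apply: finite_image; exact: finite_finset.
move=> F fF; exists [set y | `[< F (val y) >]]%SET => //.
rewrite [RHS](face_hull fF); congr cone_hull; apply/seteqP; split=> x /=.
  by move=> [y]; rewrite inE => /asboolP Fy ->; split=> //; exact: valP.
move=> [xs Fx]; exists (SeqSub xs) => //; rewrite inE; exact/asboolP.
Qed.

Lemma lin_span_cone A v : lin_span (cone_hull A) v ->
  exists x y, [/\ cone_hull A x, cone_hull A y & v = x - y].
Proof.
move=> [s + ->]; elim: s => [|[r z] s IH] sA.
  by exists 0, 0; rewrite big_nil subr0; split=> //; exact: cone_hull0.
have Cz : cone_hull A z := sA _ (mem_head _ _).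
have [|x [y [Cx Cy E]]] := IH; first by move=> q qs; apply: sA; rewrite inE qs orbT.
rewrite big_cons E /=; have [r0|r0] := leP 0 r.
  exists (r *: z + x), y; split=> //; last by rewrite addrA.
  by apply: cone_hullD => //; exact: cone_hullZ.
exists x, (y + (- r) *: z); split=> //.
  by apply: cone_hullD => //; apply: cone_hullZ; rewrite // oppr_ge0 ltW.
by rewrite opprD scaleNr opprK [RHS]addrA [RHS]addrC.
Qed.

Lemma sub_lin_span A : A `<=` lin_span A.
Proof.
move=> x Ax; exists [:: (1, x)]; last by rewrite big_seq1 scale1r.
by move=> p; rewrite inE => /eqP->.
Qed.

Lemma lin_spanB A x y : lin_span A x -> lin_span A y -> lin_span A (x - y).
Proof.
move=> [s sA ->] [t tA ->]; exists (s ++ [seq (- p.1, p.2) | p <- t]).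
  by move=> p; rewrite mem_cat => /orP[/sA//|/mapP[q /tA ? ->]].
rewrite big_cat /= big_map -sumrN; congr (_ + _).
by apply: eq_bigr => p _; rewrite scaleNr.
Qed.

Lemma monoid_hull0 A : monoid_hull A 0.
Proof. by exists [::]; rewrite ?big_nil. Qed.

Lemma monoid_hullD A x y :
  monoid_hull A x -> monoid_hull A y -> monoid_hull A (x + y).
Proof.
move=> [s sA ->] [t tA ->]; exists (s ++ t); last by rewrite big_cat.
by move=> p; rewrite mem_cat => /orP[/sA|/tA].
Qed.

Lemma sub_monoid_hull A : A `<=` monoid_hull A.
Proof.
move=> x Ax; exists [:: x]; last by rewrite big_seq1.
by move=> p; rewrite inE => /eqP->.
Qed.

Lemma monoid_ind A (P : 'rV[R]_n -> Prop) : P 0 ->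
  (forall x v, A x -> monoid_hull A v -> P v -> P (x + v)) ->
  forall v, monoid_hull A v -> P v.
Proof.
move=> P0 PD v [s sA ->]; suff [] : P (\sum_(p <- s) p) /\
  monoid_hull A (\sum_(p <- s) p) by [].
elim: s sA => [|p s IH] sA; first by rewrite big_nil; split=> //; exact: monoid_hull0.
have pA := sA p (mem_head _ _).
have [|Ps Cs] := IH; first by move=> q qs; apply: sA; rewrite inE qs orbT.
rewrite big_cons; split; first exact: PD.
by apply: monoid_hullD => //; exact: sub_monoid_hull.
Qed.

End Hulls.

Definition integral {R : realType} {n : nat} (v : 'rV[R]_n) :=
  forall i, v 0 i \is a Num.int.

(* The isomorphism of the linear spans extending phi is given as the restriction
   of a linear map defined on the ambient space. *)
Definition cone_iso {R : realType} {m n : nat}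
    (C : set 'rV[R]_m) (D : set 'rV[R]_n) (phi : 'rV[R]_m -> 'rV[R]_n) :=
  set_bij C D phi /\
  exists2 f : {linear 'rV[R]_m -> 'rV[R]_n},
    set_bij (lin_span C) (lin_span D) f & forall v, C v -> phi v = f v.

Definition monoid_iso {R : realType} {m n : nat}
    (M : set 'rV[R]_m) (N : set 'rV[R]_n) (phi : 'rV[R]_m -> 'rV[R]_n) :=
  [/\ set_bij M N phi, phi 0 = 0 &
      forall x y, M x -> M y -> phi (x + y) = phi x + phi y].

(* The set Sigma of faces consists of subsets of an ambient type X; the maps
   cdim, cone and chart are relevant on elements of Sigma only. *)
Record complex_data (R : realType) (X : choiceType) := ComplexData {
  faces : set (set X);
  cdim : set X -> nat;
  cone : forall c : set X, set 'rV[R]_(cdim c);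
  chart : forall c : set X, 'rV[R]_(cdim c) -> X }.

Arguments faces {R X} S c : rename.
Arguments cdim {R X} S c : rename.
Arguments cone {R X} S c v : rename.
Arguments chart {R X} S c v : rename.

(* The inverse of chart S c : cone S c -> c; only relevant on c. *)
Definition coord {R : realType} {X : choiceType} (S : complex_data R X)
    (c : set X) (x : X) : 'rV[R]_(cdim S c) :=
  xget 0 [set v | cone S c v /\ chart S c v = x].

Definition is_conical_complex {R : realType} {X : choiceType}
    (S : complex_data R X) :=
  [/\ finite_set (faces S),
      forall c, faces S c -> full_dim_cone (cone S c),
      forall c, faces S c -> set_bij (cone S c) c (chart S c),
      forall c F, faces S c -> is_face (cone S c) F ->
        faces S (chart S c @` F) &
      forall c d, faces S c -> faces S d ->
        exists F G, [/\ is_face (cone S c) F, is_face (cone S d) G,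
          c `&` d = chart S c @` F, c `&` d = chart S d @` G &
          cone_iso F G (coord S d \o chart S c)]].

Record conical_complex (R : realType) (X : choiceType) := ConicalComplex {
  complex_data_of :> complex_data R X;
  conical_complexP : is_conical_complex complex_data_of }.

Definition is_monoidal_complex {R : realType} {X : choiceType}
    (S : conical_complex R X) (M : forall c, set 'rV[R]_(cdim S c)) :=
  (forall c, faces S c ->
    [/\ M c `<=` cone S c, M c `<=` integral,
        exists s : seq 'rV[R]_(cdim S c), M c = monoid_hull [set` s] &
        cone_hull (M c) = cone S c]) /\
  (forall c d, faces S c -> faces S d ->
    monoid_iso (M c `&` chart S c @^-1` (c `&` d))
               (M d `&` chart S d @^-1` (c `&` d))
               (coord S d \o chart S c)).

Record monoidal_complex {R : realType} {X : choiceType}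
    (S : conical_complex R X) := MonoidalComplex {
  mon :> forall c : set X, set 'rV[R]_(cdim S c);
  monoidal_complexP : is_monoidal_complex mon }.

(* |M|, as a subset of |Sigma|. *)
Definition msupport {R : realType} {X : choiceType} {S : conical_complex R X}
    (M : monoidal_complex S) : set X :=
  [set x | exists2 c, faces S c & (chart S c @` M c) x].

Section ConicalTheory.
Context {R : realType} {X : choiceType} (S : conical_complex R X).

Lemma coord_spec c x : faces S c -> c x ->
  cone S c (coord S c x) /\ chart S c (coord S c x) = x.
Proof.
move=> Sc cx; have [_ _ /(_ c Sc)[_ _ sc] _ _] := conical_complexP S.
have [v Cv <-] := sc x cx.
have : exists w, cone S c w /\ chart S c w = chart S c v by exists v.
by move=> /(xgetPex 0).
Qed.

Lemma chart_face c v : faces S c -> cone S c v -> c (chart S c v).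
Proof.
by move=> Sc; have [_ _ /(_ c Sc)[fc _ _] _ _] := conical_complexP S; exact: fc.
Qed.

Lemma chart_inj c v v' : faces S c -> cone S c v -> cone S c v' ->
  chart S c v = chart S c v' -> v = v'.
Proof.
move=> Sc Cv Cv'; have [_ _ /(_ c Sc)[_ ic _] _ _] := conical_complexP S.
by apply: ic; rewrite inE.
Qed.

Lemma coordK c v : faces S c -> cone S c v -> coord S c (chart S c v) = v.
Proof.
move=> Sc Cv; have [? ?] := coord_spec Sc (chart_face Sc Cv).
exact: chart_inj Sc _ _ _.
Qed.

Lemma cone_faceE c : faces S c -> exists2 s : seq 'rV[R]_(cdim S c),
  cone S c = cone_hull [set` s] & \dim <<s>>%VS = cdim S c.
Proof. by move=> Sc; have [_ /(_ c Sc)] := conical_complexP S. Qed.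

Lemma cone_face0 c : faces S c -> cone S c 0.
Proof. by move=> /cone_faceE[s -> _]; exact: cone_hull0. Qed.

Lemma cone_faceD c x y : faces S c -> cone S c x -> cone S c y ->
  cone S c (x + y).
Proof. by move=> /cone_faceE[s -> _]; exact: cone_hullD. Qed.

Lemma cone_faceZ c r x : faces S c -> 0 <= r -> cone S c x ->
  cone S c (r *: x).
Proof. by move=> /cone_faceE[s -> _]; exact: cone_hullZ. Qed.

Definition overlap c d : set 'rV[R]_(cdim S c) :=
  [set v | cone S c v /\ d (chart S c v)].

Arguments overlap : clear implicits.

Lemma overlapP c d : faces S c -> faces S d ->
  is_face (cone S c) (overlap c d) /\
  exists A : 'M[R]_(cdim S c, cdim S d),
    forall v, overlap c d v -> coord S d (chart S c v) = v *m A.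
Proof.
move=> Sc Sd; have [_ _ _ _ /(_ c d Sc Sd)] := conical_complexP S.
move=> [F [G [fF fG EF EG [bF [f _ Ef]]]]].
have EO : overlap c d = F.
  apply/seteqP; split=> v.
    move=> [Cv dv]; have : (c `&` d) (chart S c v) by split=> //; exact: chart_face.
    rewrite EF => -[v' Fv' /chart_inj <-]//; exact: face_sub fF _ Fv'.
  move=> Fv; split; first exact: face_sub fF _ Fv.
  have : (chart S c @` F) (chart S c v) by exists v.
  by rewrite -EF => -[].
rewrite EO; split=> //; exists (lin1_mx f) => v Fv.
by rewrite mul_rV_lin1 -Ef.
Qed.

Lemma face_inter c d : faces S c -> faces S d -> faces S (c `&` d).
Proof.
move=> Sc Sd; have [_ _ _ /(_ c _ Sc) Sa /(_ c d Sc Sd)] := conical_complexP S.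
by move=> [F [G [fF fG -> EG _]]]; exact: Sa.
Qed.

End ConicalTheory.

Arguments overlap {R X} S c d.

Definition min_face {R : realType} {X : choiceType} (S : conical_complex R X)
    (x : X) : set X :=
  xget set0 [set c | [/\ faces S c, c x &
    forall d, faces S d -> d x -> c `<=` d]].

Lemma min_faceP {R : realType} {X : choiceType} (S : conical_complex R X) c x :
  faces S c -> c x ->
  [/\ faces S (min_face S x), min_face S x x &
      forall d, faces S d -> d x -> min_face S x `<=` d].
Proof.
move=> Sc cx; suff : exists c0, [/\ faces S c0, c0 x &
    forall d, faces S d -> d x -> c0 `<=` d] by move=> /(xgetPex set0).
have [/finite_seqP[s Es] _ _ _ _] := conical_complexP S.
have Ss d : faces S d -> d \in s by rewrite Es.
suff [c0 [S0 x0 H]] : exists c0, [/\ faces S c0, c0 x &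
    forall d, d \in s -> faces S d -> d x -> c0 `<=` d].
  by exists c0; split=> // d Sd; exact: H (Ss _ Sd) Sd.
elim: (s) => [|b t [c0 [S0 x0 H]]]; first by exists c.
have [[Sb bx]|Nb] := pselect (faces S b /\ b x).
  exists (c0 `&` b); split=> //; first exact: face_inter.
  move=> d; rewrite inE => /orP[/eqP-> _ _|dt Sd dx]; first exact: subIsetr.
  by apply: subset_trans (H d dt Sd dx); exact: subIsetl.
exists c0; split=> // d; rewrite inE => /orP[/eqP->|dt] Sd dx.
  by case: Nb.
exact: H.
Qed.

Definition is_min {R : realType} (A : set R) (m : R) := A m /\ lbound A m.

Definition minimum {R : realType} (A : set R) : R := xget 0 (is_min A).

Definition lift_pt {R : realType} {n : nat} (v : 'rV[R]_n) (h : R)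
  : 'rV[R]_(n + 1) := row_mx v h%:M.

Definition height {R : realType} {n : nat} (z : 'rV[R]_(n + 1)) : R :=
  rsubmx z 0 0.

Definition bottom {R : realType} {n : nat} (C : set 'rV[R]_(n + 1)) :
    set 'rV[R]_(n + 1) :=
  [set z | exists v h, z = lift_pt v h /\ is_min [set h' | C (lift_pt v h')] h].

Lemma minimumE {R : realType} (A : set R) m : is_min A m -> minimum A = m.
Proof.
move=> Am; apply: xget_subset1 => // x y [Ax lx] [Ay ly].
by apply/eqP; rewrite eq_le lx// ly.
Qed.

Section Lift.
Context {R : realType} {n : nat}.
Implicit Types (z : 'rV[R]_(n + 1)).

Lemma lift_ptK (v : 'rV[R]_n) h : lsubmx (lift_pt v h) = v.
Proof. exact: row_mxKl. Qed.

Lemma height_lift (v : 'rV[R]_n) h : height (lift_pt v h) = h.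
Proof. by rewrite /height row_mxKr mxE eqxx mulr1n. Qed.

Lemma lift_ptE z : lift_pt (lsubmx z) (height z) = z.
Proof. by rewrite /lift_pt /height -mx11_scalar hsubmxK. Qed.

Lemma lift_ptD (v v' : 'rV[R]_n) h h' :
  lift_pt v h + lift_pt v' h' = lift_pt (v + v') (h + h').
Proof. by rewrite /lift_pt add_row_mx -raddfD. Qed.

Lemma lift_ptZ r (v : 'rV[R]_n) h : r *: lift_pt v h = lift_pt (r *: v) (r * h).
Proof. by rewrite /lift_pt scale_row_mx scale_scalar_mx. Qed.

Lemma lift_ptM p (v : 'rV[R]_n) h (A : 'M_(n, p)) :
  lift_pt v h *m block_mx A 0 0 (1%:M : 'M_1) = lift_pt (v *m A) h.
Proof. by rewrite /lift_pt mul_row_block !mulmx0 addr0 add0r mulmx1. Qed.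

Lemma dotv_lift (v : 'rV[R]_n) h (u : 'cV[R]_n) :
  dotv (lift_pt v h) (col_mx u (0 : 'M_1)) = dotv v u.
Proof. by rewrite /dotv /lift_pt mul_row_col mulmx0 addr0. Qed.

End Lift.

Section Subdivision.
Context {R : realType} {X : choiceType} (S : conical_complex R X).
Context {n : nat} (a : 'I_n -> X) (w : 'I_n -> nat).

Definition lift_gens (c : set X) : set 'rV[R]_(cdim S c + 1) :=
  [set z | exists v e, [/\ cone S c v, chart S c v = a e &
                           z = lift_pt v (w e)%:R]].

Arguments lift_gens : clear implicits.

(* The cone C'_c generated by the (a_e, w_e) with a_e in C_c. *)
Definition lift_cone (c : set X) : set 'rV[R]_(cdim S c + 1) :=
  cone_hull (lift_gens c).

Arguments lift_cone : clear implicits.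

Definition ht (x : X) : R :=
  let c := min_face S x in
  minimum [set h | lift_cone c (lift_pt (coord S c x) h)].

Definition bottom_face (c : set X) (F : set 'rV[R]_(cdim S c + 1)) :=
  is_face (lift_cone c) F /\ F `<=` bottom (lift_cone c).

(* The projection of F to C_c, seen as a subset of |Sigma|. *)
Definition proj_face (c : set X) (F : set 'rV[R]_(cdim S c + 1)) : set X :=
  chart S c @` (lsubmx @` F).

Definition subdiv_faces : set (set X) :=
  [set d | exists c F, [/\ faces S c, @bottom_face c F & d = @proj_face c F]].

Lemma lift_cone_proj c z : faces S c -> lift_cone c z -> cone S c (lsubmx z).
Proof.
move=> Sc; move: z; apply: cone_ind; first by rewrite linear0; exact: cone_face0.
move=> r x v r0 [y [e [Cy _ ->]]] _ IH.
rewrite linearD linearZ /= lift_ptK; apply: cone_faceD => //.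
exact: cone_faceZ.
Qed.

Lemma finite_lift_gens c : faces S c -> finite_set (lift_gens c).
Proof.
move=> Sc; apply: (@sub_finite_set _ _
  ((fun e => lift_pt (coord S c (a e)) (w e)%:R) @` [set: 'I_n])); last first.
  by apply: finite_image; exact: finite_finset.
by move=> _ [v [e [Cv Ev ->]]]; exists e => //; rewrite -Ev coordK.
Qed.

Lemma lift_overlap_face c d F : faces S c -> faces S d ->
  is_face (lift_cone c) F ->
  is_face (lift_cone c) [set z | F z /\ d (chart S c (lsubmx z))].
Proof.
move=> Sc Sd fF; apply: (face_hull_trans (finite_lift_gens Sc) fF).
have [/faceP[u u0 OE] _] := overlapP Sc Sd.
have FC := face_sub fF.
apply/faceP; exists (col_mx u (0 : 'M_1)) => [z Fz|].
  rewrite -(lift_ptE z) dotv_lift; apply: u0; apply: lift_cone_proj => //.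
  exact: FC.
apply/seteqP; split=> z /= [Fz H]; split=> //.
  have : overlap S c d (lsubmx z) by split=> //; apply: lift_cone_proj => //; exact: FC.
  by rewrite OE => -[_ /= <-]; rewrite -{1}(lift_ptE z) dotv_lift.
have : overlap S c d (lsubmx z).
  rewrite OE; split; first by apply: lift_cone_proj => //; exact: FC.
  by move: H; rewrite -{1}(lift_ptE z) dotv_lift.
by case.
Qed.

Lemma lift_cone_transfer c d A v h : faces S c -> faces S d ->
  (forall v, overlap S c d v -> coord S d (chart S c v) = v *m A) ->
  overlap S c d v -> lift_cone c (lift_pt v h) ->
  lift_cone d (lift_pt (v *m A) h).
Proof.
move=> Sc Sd EA [Cv dv] Cvh.
have fF := lift_overlap_face Sc Sd (or_introl erefl : is_face (lift_cone c) _).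
have : [set z | lift_cone c z /\ d (chart S c (lsubmx z))] (lift_pt v h).
  by split=> //; rewrite lift_ptK.
rewrite (face_hull fF) -lift_ptM; move: (lift_pt v h).
apply: cone_ind; first by rewrite mul0mx; exact: cone_hull0.
move=> r _ y r0 [[x [e [Cx Ex ->]]] [_]]; rewrite lift_ptK => dx _ IH.
rewrite mulmxDl -scalemxAl; apply: cone_hullD => //; apply: cone_hullZ => //.
apply: sub_cone_hull; rewrite lift_ptM -EA//; exists (coord S d (chart S c x)), e.
by have [? ?] := coord_spec Sd dx; split=> //; rewrite -Ex.
Qed.

Lemma heights_indep c d x h : faces S c -> faces S d -> c x -> d x ->
  lift_cone c (lift_pt (coord S c x) h) ->
  lift_cone d (lift_pt (coord S d x) h).
Proof.
move=> Sc Sd cx dx; have [_ [A EA]] := overlapP Sc Sd.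
have [Cv Ev] := coord_spec Sc cx.
have O : overlap S c d (coord S c x) by split=> //; rewrite Ev.
move=> /(lift_cone_transfer Sc Sd EA O).
by rewrite -EA// Ev.
Qed.

Lemma htE c x : faces S c -> c x ->
  ht x = minimum [set h | lift_cone c (lift_pt (coord S c x) h)].
Proof.
move=> Sc cx; have [Sm mx _] := min_faceP Sc cx.
by congr minimum; apply/seteqP; split=> h /=; exact: heights_indep.
Qed.

Lemma bottom_ht c z : faces S c -> bottom (lift_cone c) z ->
  height z = ht (chart S c (lsubmx z)).
Proof.
move=> Sc [v [h [-> hmin]]]; rewrite height_lift lift_ptK.
have Cv : cone S c v.
  by have := lift_cone_proj Sc hmin.1; rewrite lift_ptK.
rewrite (htE Sc (chart_face Sc Cv)) coordK//; exact/esym/minimumE.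
Qed.

End Subdivision.

Arguments lift_gens {R X} S {n} a w c.
Arguments lift_cone {R X} S {n} a w c.
Arguments ht {R X} S {n} a w x.
Arguments subdiv_faces {R X} S {n} a w.
Arguments proj_face {R X} S c F.
Arguments bottom_face {R X} S {n} a w c F.

(* Coordinates on a face d of Gamma_w: d is the projection of the face sc_lift
   of the bottom of C'_c, c = sc_face; its cone is mapped injectively to
   R^(dim d) by selecting dim d of the coordinates of R^(cdim c), so that
   integral points remain integral; sc_inv is the inverse of
   sc_lift -> R^(dim d). *)
Record subdiv_chart {R : realType} {X : choiceType} (S : conical_complex R X) :=
  SubdivChart {
    sc_face : set X;
    sc_lift : set 'rV[R]_(cdim S sc_face + 1);
    sc_dim : nat;
    sc_sel : 'I_sc_dim -> 'I_(cdim S sc_face);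
    sc_inv : 'M[R]_(sc_dim, cdim S sc_face + 1) }.

Arguments sc_lift {R X S} s z : rename.
Arguments sc_sel {R X S} s i : rename.

Section SubdivisionComplex.
Context {R : realType} {X : choiceType} (S : conical_complex R X).
Context {n : nat} (a : 'I_n -> X) (w : 'I_n -> nat).

Definition sc_coord (k : subdiv_chart S) (v : 'rV[R]_(cdim S (sc_face k))) :
  'rV[R]_(sc_dim k) := colsub (sc_sel k) v.

Definition sc_cone (k : subdiv_chart S) : set 'rV[R]_(sc_dim k) :=
  [set sc_coord (lsubmx z) | z in sc_lift k].

Arguments sc_cone : clear implicits.

Definition sc_chart (k : subdiv_chart S) (u : 'rV[R]_(sc_dim k)) : X :=
  chart S (sc_face k) (lsubmx (u *m sc_inv k)).

Arguments sc_chart : clear implicits.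

Definition subdiv_chart_spec (d : set X) (k : subdiv_chart S) :=
  [/\ faces S (sc_face k), bottom_face S a w (sc_face k) (sc_lift k),
      d = proj_face S (sc_face k) (sc_lift k), full_dim_cone (sc_cone k) &
      forall z, sc_lift k z -> sc_coord (lsubmx z) *m sc_inv k = z].

Definition subdiv_chart_at (d : set X) : subdiv_chart S :=
  if pselect (exists k, subdiv_chart_spec d k) is left h then projT1 (cid h)
  else @SubdivChart R X S set0 set0 0 (fun i => False_rect _ (notF (ltn_ord i)))
         0.

Definition subdiv_data : complex_data R X :=
  @ComplexData R X (subdiv_faces S a w)
    (fun d => sc_dim (subdiv_chart_at d))
    (fun d => sc_cone (subdiv_chart_at d))
    (fun d => sc_chart (subdiv_chart_at d)).

Lemma bottom_proj_inj c F z z' : faces S c -> bottom_face S a w c F ->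
  F z -> F z' -> lsubmx z = lsubmx z' -> z = z'.
Proof.
move=> Sc [_ Fb] /Fb Bz /Fb Bz' E.
by rewrite -(lift_ptE z) -(lift_ptE z') (bottom_ht Sc Bz) (bottom_ht Sc Bz') E.
Qed.

Lemma subdiv_chart_ex c F : faces S c -> bottom_face S a w c F ->
  exists k, subdiv_chart_spec (proj_face S c F) k.
Proof.
move=> Sc bF; have [fF Fb] := bF.
have EF := face_hull fF.
have : finite_set (lift_gens S a w c `&` F).
  by apply: sub_finite_set (finite_lift_gens a w Sc); exact: subIsetl.
move=> /finite_seqP[s Es]; rewrite {}Es in EF.
pose A : 'M[R]_(size s, cdim S c + 1) := \matrix_(i < size s) s`_i.
pose B := lsubmx A.
have As (i : 'I_(size s)) : row i A = s`_i by rewrite rowK.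
have FA (x : 'rV_(size s)) : (forall i, 0 <= x 0 i) -> F (x *m A).
  move=> x0; rewrite mulmx_sum_row EF.
  apply: (big_ind (cone_hull [set` s])) => [||i _]; first exact: cone_hull0.
    exact: cone_hullD.
  by apply: cone_hullZ; rewrite ?As//; apply: sub_cone_hull; exact: mem_nth.
have AF z : F z -> exists2 x : 'rV_(size s), (forall i, 0 <= x 0 i) & z = x *m A.
  rewrite EF; move: z; apply: cone_ind => [|r y v r0 /= ys _ [x x0 ->]].
    by exists 0; rewrite ?mul0mx// => i; rewrite mxE.
  have iy : (index y s < size s)%N by rewrite index_mem.
  exists (r *: delta_mx 0 (Ordinal iy) + x).
    by move=> i; rewrite !mxE addr_ge0// mulr_ge0// ler0n.
  by rewrite mulmxDl -scalemxAl -rowE As /= nth_index.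
have Binj (x : 'rV_(size s)) : x *m B = 0 -> x *m A = 0.
  pose xp : 'rV[R]_(size s) := \row_i Num.max (x 0 i) 0.
  pose xm : 'rV[R]_(size s) := \row_i Num.max (- x 0 i) 0.
  have -> : x = xp - xm.
    apply/rowP => i; rewrite !mxE; case: (leP (x 0 i) 0) => x0.
      by rewrite max_l ?oppr_ge0// opprK add0r.
    by rewrite max_r ?oppr_le0 ?ltW// subr0.
  have Fp : F (xp *m A) by apply: FA => i; rewrite mxE le_max lexx orbT.
  have Fm : F (xm *m A) by apply: FA => i; rewrite mxE le_max lexx orbT.
  rewrite !mulmxBl => /eqP; rewrite subr_eq0 => /eqP E.
  apply/eqP; rewrite subr_eq0; apply/eqP; apply: bottom_proj_inj Sc bF Fp Fm _.
  by rewrite -!mulmx_lsub.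
pose r := \rank B^T; pose f : 'I_r -> 'I_(cdim S c) := maxrankfun B^T.
pose Bf := colsub f B.
have BfE : Bf = (rowsub f B^T)^T by apply/matrixP => i j; rewrite !mxE.
have rBf : \rank Bf = r by rewrite BfE mxrank_tr eq_maxrowsub.
have Bfinj (x : 'rV_(size s)) : x *m Bf = 0 -> x *m A = 0.
  have /submxP[D ED] : (B^T <= rowsub f B^T)%MS by rewrite eq_maxrowsub.
  move=> x0; apply: Binj; rewrite -[B]trmxK ED trmx_mul -BfE mulmxA x0.
  by rewrite mul0mx.
pose Q := pinvmx Bf *m A.
have csE (x : 'rV_(size s)) : colsub f (lsubmx (x *m A)) = x *m Bf.
  by rewrite -mulmx_lsub -mulmx_colsub.
exists (@SubdivChart R X S c F r f Q); split=> //=; last first.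
  move=> z /AF[x _ ->]; rewrite /sc_coord /= csE.
  apply/eqP; rewrite -subr_eq0; apply/eqP.
  rewrite /Q mulmxA -mulmxBl; apply: Bfinj.
  by rewrite mulmxBl mulmxKpV ?subrr// submxMl.
exists [seq row i Bf | i <- enum 'I_(size s)].
  apply/seteqP; split=> u.
    move=> [z /AF[x x0 ->] <-]; rewrite /sc_coord /= csE mulmx_sum_row.
    apply: (big_ind (cone_hull _)) => [||i _]; first exact: cone_hull0.
      exact: cone_hullD.
    apply: cone_hullZ => //; apply: sub_cone_hull => /=.
    by apply/mapP; exists i; rewrite ?mem_enum.
  move: u; apply: cone_ind => [|t y u t0 /mapP[i _ ->] _ [z /AF[x x0 ->] <-]].
    exists 0; first by rewrite EF; exact: cone_hull0.
    by apply/rowP => j; rewrite !mxE.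
  exists ((t *: delta_mx 0 i + x) *m A).
    by apply: FA => j; rewrite !mxE addr_ge0// mulr_ge0// ler0n.
  by rewrite /sc_coord /= !csE mulmxDl -scalemxAl -rowE.
have -> : <<[seq row i Bf | i <- enum 'I_(size s)]>>%VS = fullv.
  apply/eqP; rewrite eqEsubv subvf /=; apply/subvP => v _.
  have /submxP[x ->] : (v <= Bf)%MS by rewrite submx_full// /row_full rBf.
  rewrite mulmx_sum_row; apply: rpred_sum => i _; apply: rpredZ.
  by apply: memv_span; apply/mapP; exists i; rewrite ?mem_enum.
by rewrite dimvf dim_matrix; exact: mul1n.
Qed.

Lemma subdiv_chart_atP d : subdiv_faces S a w d ->
  subdiv_chart_spec d (subdiv_chart_at d).
Proof.
move=> [c [F [Sc bF dE]]]; rewrite /subdiv_chart_at.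
case: pselect => [h|[]]; first exact: projT2 (cid h).
by rewrite dE; exact: subdiv_chart_ex.
Qed.

End SubdivisionComplex.

Arguments sc_cone {R X S} k u.
Arguments sc_chart {R X S} k u.
Arguments subdiv_chart_at {R X} S {n} a w d.

Section SubdivisionTheory.
Context {R : realType} {X : choiceType} (S : conical_complex R X).
Context {n : nat} (a : 'I_n -> X) (w : 'I_n -> nat).

Local Notation D := (subdiv_data S a w).
Local Notation K := (subdiv_chart_at S a w).

Lemma face_restrict m (C F G : set 'rV[R]_m) : is_face C G -> F `<=` C ->
  G `<=` F -> is_face F G.
Proof.
move=> /faceP[u u0 GE] FC GF; apply/faceP; exists u => [v /FC/u0//|].
apply/seteqP; split=> v; first by move=> Gv; split; [exact: GF|move: Gv; rewrite GE => -[]].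
by move=> [/FC Cv v0]; rewrite GE.
Qed.

Lemma lin_span_bij p q (A : set 'rV[R]_p) (B : set 'rV[R]_q)
    (f : {linear 'rV[R]_p -> 'rV[R]_q}) :
  set_bij (cone_hull A) (cone_hull B) f ->
  set_bij (lin_span (cone_hull A)) (lin_span (cone_hull B)) f.
Proof.
move=> [fun_f inj_f surj_f]; split.
- move=> v /lin_span_cone[x [y [Ax Ay ->]]]; rewrite linearB.
  by apply: lin_spanB; apply: sub_lin_span; exact: fun_f.
- move=> v v'; rewrite !inE => /lin_span_cone[x [y [Ax Ay ->]]].
  move=> /lin_span_cone[x' [y' [Ax' Ay' ->]]]; rewrite !linearB => /eqP.
  rewrite subr_eq addrAC eq_sym subr_eq -!linearD => /eqP/inj_f.
  rewrite !inE => /(_ (cone_hullD Ax' Ay) (cone_hullD Ax Ay')) E.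
  by apply/eqP; rewrite subr_eq addrAC eq_sym subr_eq; apply/eqP.
- move=> v /lin_span_cone[x [y [/surj_f[x' Ax' <-] /surj_f[y' Ay' <-] ->]]].
  by exists (x' - y'); [apply: lin_spanB; exact: sub_lin_span|rewrite linearB].
Qed.

Lemma coord_bijK (C : complex_data R X) c v : set_bij (cone C c) c (chart C c) ->
  cone C c v -> coord C c (chart C c v) = v.
Proof.
move=> [_ ic _] Cv.
have : exists u, cone C c u /\ chart C c u = chart C c v by exists v.
by move=> /(xgetPex 0)[Cu Eu]; apply: ic; rewrite ?inE.
Qed.

Lemma sc_coord0 (k : subdiv_chart S) : sc_coord (lsubmx (0 : 'rV_(_ + 1))) = 0 :> 'rV_(sc_dim k).
Proof. by apply/rowP => j; rewrite !mxE. Qed.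

Lemma sc_coordZD (k : subdiv_chart S) r (x y : 'rV_(_ + 1)) :
  sc_coord (lsubmx (r *: x + y)) =
  r *: sc_coord (lsubmx x) + sc_coord (lsubmx y) :> 'rV_(sc_dim k).
Proof. by apply/rowP => j; rewrite !mxE. Qed.

Section OneFace.
Variables (d : set X) (k : subdiv_chart S).
Hypothesis kP : subdiv_chart_spec a w d k.
Let c := sc_face k.
Let F := sc_lift k.

Lemma scK z : F z -> sc_chart k (sc_coord (lsubmx z)) = chart S c (lsubmx z).
Proof. by case: kP => _ _ _ _ H Fz; rewrite /sc_chart H. Qed.

Lemma sc_liftC z : F z -> lift_cone S a w c z.
Proof. by case: kP => _ [fF _] _ _ _; exact: face_sub. Qed.

Lemma sc_lift_cone z : F z -> cone S c (lsubmx z).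
Proof.
by case: kP => Sc _ _ _ _ /sc_liftC; exact: lift_cone_proj.
Qed.

Lemma sc_lift_face z : F z -> d (chart S c (lsubmx z)).
Proof.
by case: kP => _ _ -> _ _ Fz; exists (lsubmx z) => //; exists z.
Qed.

Lemma sc_bij : set_bij (sc_cone k) d (sc_chart k).
Proof.
have [Sc bF dE _ _] := kP; split.
- by move=> _ [z Fz <-]; rewrite scK//; exact: sc_lift_face.
- move=> u u'; rewrite !inE => -[z Fz <-] [z' Fz' <-]; rewrite !scK// => E.
  congr (sc_coord (lsubmx _)); apply: (bottom_proj_inj Sc bF) => //.
  by apply: chart_inj Sc _ _ E; exact: sc_lift_cone.
- rewrite dE => x [_ [z Fz <-] <-]; exists (sc_coord (lsubmx z)); last exact: scK.
  by exists z.
Qed.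

Lemma dotv_sc z (u : 'cV[R]_(sc_dim k)) : dotv (@sc_coord _ _ _ k (lsubmx z)) u =
  dotv z (col_mx (colsub (sc_sel k) 1%:M *m u) (0 : 'M_1)).
Proof.
rewrite -[z in RHS](lift_ptE z) dotv_lift /dotv /sc_coord mulmxA.
by rewrite mulmx_colsub mulmx1.
Qed.

Lemma sc_face_pull G : is_face (sc_cone k) G ->
  bottom_face S a w c [set z | F z /\ G (sc_coord (lsubmx z))] /\
  sc_chart k @` G = proj_face S c [set z | F z /\ G (sc_coord (lsubmx z))].
Proof.
have [Sc [fF Fb] dE _ kK] := kP; move=> fG; split.
  split; last by move=> z [/Fb].
  apply: (face_hull_trans (finite_lift_gens a w Sc) fF).
  have [u u0 GE] := (faceP _ _).1 fG; apply/faceP.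
  exists (col_mx (colsub (sc_sel k) 1%:M *m u) (0 : 'M_1)) => [z Fz|].
    by rewrite -dotv_sc; apply: u0; exists z.
  apply/seteqP; split=> z /= [Fz]; rewrite -dotv_sc GE; first by case.
  by move=> z0; split=> //; split=> //; exists z.
apply/seteqP; split=> x.
  move=> [u Gu <-]; have [z Fz zu] := face_sub fG Gu.
  by exists (lsubmx z); [exists z => //; split=> //; rewrite zu|rewrite -scK// zu].
move=> [_ [z [Fz Gz] <-] <-]; exists (sc_coord (lsubmx z)) => //; exact: scK.
Qed.

Lemma sc_face_push G : is_face F G ->
  is_face (sc_cone k) [set u | sc_cone k u /\ G (u *m sc_inv k)].
Proof.
have [_ _ _ _ kK] := kP; move=> /faceP[u u0 GE]; apply/faceP.
have dE z : F z -> dotv (sc_coord (lsubmx z)) (sc_inv k *m u) = dotv z u.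
  by move=> Fz; rewrite /dotv mulmxA kK.
exists (sc_inv k *m u) => [_ [z Fz <-]|]; first by rewrite dE// u0.
apply/seteqP; split=> _ /= [[z Fz <-]]; rewrite kK//.
  by rewrite GE => -[_ /= z0]; split; [exists z|rewrite dE].
by rewrite dE// => z0; split; [exists z|rewrite GE].
Qed.

Lemma sc_invP u : sc_cone k u ->
  F (u *m sc_inv k) /\ sc_coord (lsubmx (u *m sc_inv k)) = u.
Proof. by have [_ _ _ _ kK] := kP; move=> [z Fz <-]; rewrite kK. Qed.

End OneFace.

Section TwoFaces.
Variables (d d' : set X) (k k' : subdiv_chart S).
Hypothesis kP : subdiv_chart_spec a w d k.
Hypothesis kP' : subdiv_chart_spec a w d' k'.
Let c := sc_face k.
Let c' := sc_face k'.

Definition sc_overlap : set 'rV[R]_(sc_dim k) :=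
  [set u | sc_cone k u /\ d' (sc_chart k u)].

Arguments sc_overlap : clear implicits.

Lemma sc_overlapP : is_face (sc_cone k) sc_overlap /\
  exists f : {linear 'rV[R]_(sc_dim k) -> 'rV[R]_(sc_dim k')},
    forall u, sc_overlap u -> sc_cone k' (f u) /\ sc_chart k' (f u) = sc_chart k u.
Proof.
have [Sc [fF Fb] dE [s sE _] kK] := kP.
have [Sc' [fF' Fb'] dE' _ kK'] := kP'.
have [_ [A EA]] := overlapP Sc Sc'.
pose T : 'M[R]_(cdim S c + 1, cdim S c' + 1) := block_mx A 0 0 1%:M.
pose F1 := [set z | sc_lift k z /\ c' (chart S c (lsubmx z))].
pose G := [set z | sc_lift k z /\ d' (chart S c (lsubmx z))].
have dc' x : d' x -> c' x.
  rewrite dE' => -[_ [z Fz <-] <-]; apply: chart_face => //.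
  exact: sc_lift_cone kP' _ Fz.
have GT z : G z -> sc_lift k' (z *m T) /\
    chart S c' (lsubmx (z *m T)) = chart S c (lsubmx z).
  move=> [Fz d'x]; move: (d'x); rewrite dE' => -[_ [z' Fz' <-] E].
  have Cz := sc_lift_cone kP Fz; have Cz' := sc_lift_cone kP' Fz'.
  suff -> : z *m T = z' by [].
  rewrite -[z in LHS](lift_ptE z) lift_ptM -(lift_ptE z').
  rewrite (bottom_ht Sc (Fb _ Fz)) (bottom_ht Sc' (Fb' _ Fz')) E -EA//; last first.
    by split=> //; exact: dc'.
  by congr lift_pt; rewrite -/c -E coordK.
have TG z : F1 z -> sc_lift k' (z *m T) -> G z.
  move=> [Fz c'z] F'z; split=> //; rewrite dE'.
  have Cz := sc_lift_cone kP Fz.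
  exists (lsubmx (z *m T)); first by exists (z *m T).
  rewrite -[z in LHS](lift_ptE z) lift_ptM lift_ptK -EA//.
  by have [_ ->] := coord_spec Sc' c'z.
have fF1 : is_face (lift_cone S a w c) F1 by exact: lift_overlap_face.
have fG : is_face (sc_lift k) G.
  have [u u0 FE'] := (faceP _ _).1 fF'.
  have T0 z : F1 z -> lift_cone S a w c' (z *m T).
    move=> [Fz c'z]; rewrite -(lift_ptE z) lift_ptM.
    apply: (lift_cone_transfer Sc Sc' EA); last by rewrite lift_ptE; exact: face_sub Fz.
    by split=> //; exact: sc_lift_cone kP _ Fz.
  apply: face_restrict (face_sub fF) _; last by move=> z [].
  apply: (face_hull_trans (finite_lift_gens a w Sc) fF1).
  apply/faceP; exists (T *m u) => [z /T0/u0|]; first by rewrite /dotv mulmxA.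
  apply/seteqP; split=> z.
    move=> Gz; have [Fz d'z] := Gz; split; first by split=> //; exact: dc'.
    by have [] := GT z Gz; rewrite FE' => -[_ /=]; rewrite /dotv mulmxA.
  move=> [F1z /= z0]; apply: TG => //; rewrite FE'; split; first exact: T0.
  by move: z0; rewrite /dotv mulmxA.
have OE : sc_overlap = [set u | sc_cone k u /\ G (u *m sc_inv k)].
  apply/seteqP; split=> u [Cu]; have [Fu Eu] := sc_invP kP Cu.
    by move=> d'u; split.
  by move=> [_ d'u]; split.
split; first by rewrite OE; exact: sc_face_push kP _ fG.
pose M := colsub (sc_sel k') (lsubmx (sc_inv k *m T)).
exists (mulmxr M) => u; rewrite OE => -[Cu /GT[F'z Ez]].
have E : u *m M = sc_coord (lsubmx (u *m sc_inv k *m T)).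
  by rewrite /M mulmx_colsub mulmx_lsub mulmxA.
rewrite /= E.
by split; [exists (u *m sc_inv k *m T)|rewrite (scK kP')].
Qed.

End TwoFaces.

Arguments sc_overlap : clear implicits.

Lemma subdiv_conical : is_conical_complex D.
Proof.
have KP := @subdiv_chart_atP R X S n a w.
have bijD d : subdiv_faces S a w d -> set_bij (cone D d) d (chart D d).
  by move=> Dd; exact: sc_bij (KP d Dd).
split.
- have [finS _ _ _ _] := conical_complexP S.
  apply: (@sub_finite_set _ _ (\bigcup_(c in faces S)
    (proj_face S c @` is_face (lift_cone S a w c)))).
    by move=> d [c [F [Sc [fF _] ->]]]; exists c => //; exists F.
  apply: bigcup_finite => // c Sc; apply: finite_image; apply: finite_faces.
  exact: finite_lift_gens.
- by move=> d Dd; have [] := KP d Dd.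
- exact: bijD.
- move=> d G Dd fG; have [bG EG] := sc_face_pull (KP d Dd) fG.
  have [Sc _ _ _ _] := KP d Dd; exists (sc_face (K d)).
  by exists [set z | sc_lift (K d) z /\ G (sc_coord (lsubmx z))]; split.
- move=> d d' Dd Dd'.
  have [fO [f Hf]] := sc_overlapP (KP d Dd) (KP d' Dd').
  have [fO' [f' Hf']] := sc_overlapP (KP d' Dd') (KP d Dd).
  have OE (e e' : set X) (De : subdiv_faces S a w e) : e `&` e' = chart D e @` (sc_overlap e' (K e)).
    have [fe _ se] := bijD e De; apply/seteqP; split=> x.
      by move=> [/se[u Cu <-] e'u]; exists u.
    by move=> [u [Cu e'u] <-]; split=> //; exact: fe.
  have cf u : sc_overlap d' (K d) u -> (coord D d' \o chart D d) u = f u.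
    move=> /Hf[Cfu Efu]; rewrite /comp; have := coord_bijK (bijD d' Dd') Cfu.
    by move: Efu => /= ->.
  have bij_f : set_bij (sc_overlap d' (K d)) (sc_overlap d (K d')) f.
    have [fd id _] := bijD d Dd; have [fd' id' _] := bijD d' Dd'.
    split.
    - move=> u Ou; have [Cfu Efu] := Hf u Ou; split=> //.
      by rewrite Efu; have [Cu _] := Ou; exact: fd.
    - move=> u v; rewrite !inE => Ou Ov E; apply: id; rewrite ?inE.
      + by case: Ou.
      + by case: Ov.
      by have [_ /= <-] := Hf u Ou; have [_ /= <-] := Hf v Ov; rewrite E.
    - move=> u Ou; have [Cf'u Ef'u] := Hf' u Ou; have [Cu du] := Ou.
      have Of : sc_overlap d' (K d) (f' u) by split=> //; rewrite Ef'u; exact: fd'.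
      exists (f' u) => //; apply: id'; rewrite ?inE; [by case: (Hf _ Of)|by []|].
      by have [_ /= ->] := Hf _ Of.
  exists (sc_overlap d' (K d)), (sc_overlap d (K d')); split=> //.
  + exact: OE.
  + by rewrite setIC; exact: OE.
  + split.
      by apply: eq_set_bijLR bij_f => u; rewrite inE; exact: cf.
    exists f => //.
    have [_ _ _ [s sE _] _] := KP d Dd; have [_ _ _ [s' sE' _] _] := KP d' Dd'.
    move: fO fO' bij_f; rewrite sE sE' => /face_hull -> /face_hull ->.
    exact: lin_span_bij.
Qed.

(* Gamma_w. *)
Definition subdivision : conical_complex R X := ConicalComplex subdiv_conical.

Lemma subdiv_overlap_lin d d' : subdiv_faces S a w d -> subdiv_faces S a w d' ->
  is_face (cone subdivision d) (overlap subdivision d d') /\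
  exists f : {linear 'rV[R]_(cdim D d) -> 'rV[R]_(cdim D d')},
    forall u, overlap subdivision d d' u -> coord D d' (chart D d u) = f u.
Proof.
move=> Dd Dd'; have [? [A EA]] := @overlapP _ _ subdivision d d' Dd Dd'.
by split=> //; exists (mulmxr A).
Qed.

End SubdivisionTheory.

Section WeightedComplex.
Context {R : realType} {X : choiceType} {S : conical_complex R X}.
Context (M : monoidal_complex S) {n : nat} (a : 'I_n -> X).
Hypothesis aM : forall e, msupport M (a e).
Variable w : 'I_n -> nat.

Local Notation D := (subdivision S a w).

(* N_(d,w). *)
Definition weighted_mon (d : set X) : set 'rV[R]_(cdim D d) :=
  monoid_hull [set u | cone D d u /\
                       exists2 e, chart D d u = a e & ht S a w (a e) = (w e)%:R].

Arguments weighted_mon : clear implicits.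

Lemma mon_coord c x : faces S c -> c x -> msupport M x -> M c (coord S c x).
Proof.
move=> Sc cx [c1 Sc1 [v Mv vx]].
have [_ /(_ c1 c Sc1 Sc)[[+ _ _] _ _]] := monoidal_complexP M.
move=> /(_ v) /=; rewrite vx => -[]//; split=> //; split=> //.
have [/(_ c1 Sc1)[sub _ _ _] _] := monoidal_complexP M.
by rewrite /= -vx; apply: chart_face => //; exact: sub.
Qed.

Lemma weighted_monoidal : is_monoidal_complex weighted_mon.
Proof.
have cD d x y : faces D d -> cone D d x -> cone D d y -> cone D d (x + y).
  exact: cone_faceD.
have Ncone d : faces D d -> weighted_mon d `<=` cone D d.
  move=> Dd; apply: monoid_ind; first exact: cone_face0.
  by move=> x v [Cx _] _; exact: cone_faceD.
split=> [d Dd|d d' Dd Dd'].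
  have kP := @subdiv_chart_atP R X S n a w d Dd.
  have [Sc [fF Fb] dE _ kK] := kP.
  split.
  - exact: Ncone.
  - apply: monoid_ind => [i|x v [[z Fz <-] [e Ee _]] _ iv i].
      by rewrite mxE rpred0.
    rewrite mxE rpredD// mxE.
    have [/(_ _ Sc)[_ + _ _] _] := monoidal_complexP M; apply.
    move: Ee; rewrite /= (scK kP)// => Ee.
    have Cz := sc_lift_cone kP Fz.
    rewrite -(coordK Sc Cz) Ee; apply: mon_coord => //.
    by rewrite -Ee; exact: chart_face.
  - have /finite_seqP[s sE] : finite_set [set u | cone D d u /\
        exists2 e, chart D d u = a e & ht S a w (a e) = (w e)%:R].
      apply: (@sub_finite_set _ _ ((fun e => coord D d (a e)) @` [set: 'I_n])).
        by move=> u [Cu [e Eu _]]; exists e => //; rewrite -Eu coordK.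
      by apply: finite_image; exact: finite_finset.
    by exists s; rewrite /weighted_mon sE.
  - apply/seteqP; split.
      apply: cone_hull_min; last exact: Ncone.
      + exact: cone_face0.
      + by move=> x y; exact: cone_faceD.
      + by move=> r x; exact: cone_faceZ.
    move=> _ [z + <-]; rewrite (face_hull fF); move: z; apply: cone_ind.
      by rewrite sc_coord0; exact: cone_hull0.
    move=> r x y r0 [[v [e [Cv Ev xE]]] Fx] _ IH.
    rewrite sc_coordZD; apply: cone_hullD => //; apply: cone_hullZ => //.
    apply: sub_cone_hull; apply: sub_monoid_hull; split; first by exists x.
    have Ex : lsubmx x = v by rewrite xE lift_ptK.
    exists e; first by rewrite /= (scK kP)// Ex.
    by have := bottom_ht Sc (Fb _ Fx); rewrite Ex Ev => <-; rewrite xE height_lift.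
have transfer d1 d2 u : faces D d1 -> faces D d2 ->
    weighted_mon d1 u -> (d1 `&` d2) (chart D d1 u) ->
    weighted_mon d2 (coord D d2 (chart D d1 u)).
  move=> D1 D2 + [_ d2u].
  have [fO [f Hf]] := subdiv_overlap_lin D1 D2.
  move=> Nu; have Ou : overlap D d1 d2 u by split=> //; exact: Ncone Nu.
  rewrite [coord _ _ _]Hf//; move: u Nu Ou {d2u}.
  apply: monoid_ind => [_|x v [Cx [e xe hte]] Nv IH Oxv].
    by rewrite linear0; exact: monoid_hull0.
  have Cv := Ncone d1 D1 v Nv.
  have Ox : overlap D d1 d2 x by exact: face_extremal fO Cx Cv Oxv.
  have Ov : overlap D d1 d2 v by apply: face_extremal fO Cv Cx _; rewrite addrC.
  rewrite linearD; apply: monoid_hullD; last exact: IH.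
  apply: sub_monoid_hull; rewrite -Hf//; have [_ d2x] := Ox.
  have [? E] := coord_spec (S := D) D2 d2x; split=> //.
  by exists e => //; rewrite E.
have [fO [f Hf]] := subdiv_overlap_lin Dd Dd'.
have sO u : (weighted_mon d `&` chart D d @^-1` (d `&` d')) u -> overlap D d d' u.
  by move=> [Nu [_ d'u]]; split=> //; exact: Ncone Nu.
have O0 : overlap D d d' 0.
  have [t tE _] := cone_faceE (S := D) Dd.
  by move: fO; rewrite tE => /face_hull ->; exact: cone_hull0.
split.
- split.
  + move=> u [Nu [du d'u]]; split; first exact: transfer.
    have [C' E] := coord_spec (S := D) Dd' d'u.
    suff : (d `&` d') (chart D d' (coord D d' (chart D d u))) by [].
    by rewrite E; split.
  + move=> u v; rewrite !inE => -[Nu [du d'u]] [Nv [dv d'v]] E.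
    apply: (chart_inj (S := D) Dd); [exact: Ncone Nu|exact: Ncone Nv|].
    have [_ <-] := coord_spec (S := D) Dd' d'u.
    by have [_ <-] := coord_spec (S := D) Dd' d'v; move: E => /= ->.
  + move=> u [Nu [du d'u]]; exists (coord D d (chart D d' u)).
      have [C E] := coord_spec (S := D) Dd du.
      split; first by apply: transfer => //; rewrite setIC.
      suff : (d `&` d') (chart D d (coord D d (chart D d' u))) by [].
      by rewrite E.
    have [_ E] := coord_spec (S := D) Dd du.
    rewrite /comp E; apply: (coordK (S := D)) => //; exact: Ncone Nu.
- by rewrite /comp Hf// linear0.
- move=> x y /[dup] Hx /sO Ox /[dup] Hy /sO Oy; rewrite /comp !Hf ?linearD//.
  have [t tE _] := cone_faceE (S := D) Dd.
  by move: fO Ox Oy; rewrite tE => /face_hull ->; exact: cone_hullD.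
Qed.

(* M_w. *)
Definition weighted_complex : monoidal_complex D :=
  MonoidalComplex weighted_monoidal.

End WeightedComplex.

Arguments weighted_complex {R X S} M {n a} aM w.

Definition add_in {R : realType} {X : choiceType} (S : conical_complex R X)
    (c : set X) (x y : X) : X :=
  chart S c (coord S c x + coord S c y).

Section AddIn.
Context {R : realType} {X : choiceType} {S : conical_complex R X}.
Implicit Types (c d : set X) (x y : X).

Lemma mon_faceP (M : monoidal_complex S) c : faces S c ->
  [/\ M c `<=` cone S c, M c 0 & forall u v, M c u -> M c v -> M c (u + v)].
Proof.
move=> Sc; have [/(_ c Sc)[sub _ [s ME] _] _] := monoidal_complexP M.
split; first exact: sub.
  by rewrite ME; exact: monoid_hull0.
by rewrite ME; exact: monoid_hullD.
Qed.

Lemma mon_support (M : monoidal_complex S) c u : faces S c -> M c u ->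
  msupport M (chart S c u).
Proof. by move=> Sc Mu; exists c => //; exists u. Qed.

Lemma add_in_face c x y : faces S c -> c x -> c y -> c (add_in S c x y).
Proof.
move=> Sc cx cy; have [Cx _] := coord_spec Sc cx; have [Cy _] := coord_spec Sc cy.
by apply: chart_face => //; exact: cone_faceD.
Qed.

Lemma coord_add_in c x y : faces S c -> c x -> c y ->
  coord S c (add_in S c x y) = coord S c x + coord S c y.
Proof.
move=> Sc cx cy; have [Cx _] := coord_spec Sc cx; have [Cy _] := coord_spec Sc cy.
by apply: coordK => //; exact: cone_faceD.
Qed.

Lemma add_in_support (M : monoidal_complex S) c x y : faces S c -> c x -> c y ->
  msupport M x -> msupport M y -> msupport M (add_in S c x y).
Proof.
move=> Sc cx cy Mx My; have [_ _ MD] := mon_faceP M Sc.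
by apply: mon_support => //; apply: MD; exact: mon_coord.
Qed.

Lemma add_inC c x y : add_in S c x y = add_in S c y x.
Proof. by rewrite /add_in addrC. Qed.

Lemma add_in_extremal c d x y : faces S c -> faces S d -> c x -> c y ->
  d (add_in S c x y) -> d x.
Proof.
move=> Sc Sd cx cy; have [Cx Ex] := coord_spec Sc cx.
have [Cy _] := coord_spec Sc cy; have [fO _] := overlapP Sc Sd.
move=> dxy; have O : overlap S c d (coord S c x + coord S c y).
  by split=> //; exact: cone_faceD.
by have [] := face_extremal fO Cx Cy O; rewrite Ex.
Qed.

Lemma add_in_indep c d x y : faces S c -> faces S d -> c x -> c y ->
  d x -> d y -> add_in S c x y = add_in S d x y.
Proof.
move=> Sc Sd cx cy dx dy; have [Cx Ex] := coord_spec Sc cx.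
have [Cy Ey] := coord_spec Sc cy; have [fO [A EA]] := overlapP Sc Sd.
have Ox : overlap S c d (coord S c x) by split=> //; rewrite Ex.
have Oy : overlap S c d (coord S c y) by split=> //; rewrite Ey.
have Oxy : overlap S c d (coord S c x + coord S c y).
  have [s sE _] := cone_faceE Sc; move: fO Ox Oy; rewrite sE => /face_hull ->.
  exact: cone_hullD.
have Edx : coord S d x = coord S c x *m A by rewrite -EA// Ex.
have Edy : coord S d y = coord S c y *m A by rewrite -EA// Ey.
rewrite [RHS]/add_in Edx Edy -mulmxDl -EA//.
by have [_ ->] := coord_spec Sd Oxy.2.
Qed.

Lemma face_zero c d : faces S c -> faces S d -> d (chart S c 0).
Proof.
move=> Sc Sd; have [fO _] := overlapP Sc Sd.
have [s sE _] := cone_faceE Sc.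
suff : overlap S c d 0 by case.
by move: fO; rewrite sE => /face_hull ->; exact: cone_hull0.
Qed.

Lemma chart0_indep c d : faces S c -> faces S d -> chart S c 0 = chart S d 0.
Proof.
move=> Sc Sd; have [_ [A EA]] := overlapP Sc Sd.
have O : overlap S c d 0 by split; [exact: cone_face0|exact: face_zero].
have [_ <-] := coord_spec Sd (face_zero Sc Sd).
by rewrite EA// mul0mx.
Qed.

End AddIn.

Local Notation "<< x >>" := (monalg.mkmalgU x 1) : ring_scope.

Section MalgExt.
Context {T : choiceType} {K : comNzRingType} {V : lmodType K}.
Implicit Types (f g : monalg.malg T K) (h : T -> V).

Definition malg_ext h f : V := \sum_(x <- monalg.msupp f) monalg.mcoeff x f *: h x.

Lemma malg_extw h f (d : {fset T}) : (monalg.msupp f `<=` d)%fset ->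
  malg_ext h f = \sum_(x <- d) monalg.mcoeff x f *: h x.
Proof.
move=> le; rewrite /malg_ext (big_fset_incl _ le)// => x _ /monalg.mcoeff_outdom ->.
by rewrite scale0r.
Qed.

Lemma malg_extD h f g : malg_ext h (f + g) = malg_ext h f + malg_ext h g.
Proof.
rewrite (malg_extw h (monalg.msuppD_le f g)) (malg_extw h (fsubsetUl _ (monalg.msupp g))).
rewrite (malg_extw h (fsubsetUr (monalg.msupp f) _)) -big_split.
by apply: eq_bigr => x _; rewrite monalg.mcoeffD scalerDl.
Qed.

Lemma malg_extZ h k f : malg_ext h (k *: f) = k *: malg_ext h f.
Proof.
rewrite (malg_extw h (monalg.msuppZ_le k f)) scaler_sumr.
by apply: eq_bigr => x _; rewrite monalg.mcoeffZ scalerA.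
Qed.

Lemma malg_ext0 h : malg_ext h 0 = 0.
Proof. by rewrite /malg_ext monalg.msupp0 big_nil. Qed.

Lemma malg_extU h x : malg_ext h << x >> = h x.
Proof. by rewrite (malg_extw h (monalg.msuppU_le)) big_seq_fset1 monalg.mcoeffUU scale1r. Qed.

End MalgExt.

Lemma malg_ind {T : choiceType} {K : comNzRingType} (P : monalg.malg T K -> Prop) :
  P 0 -> (forall f g, P f -> P g -> P (f + g)) ->
  (forall k f, P f -> P (k *: f)) -> (forall x, P << x >>) -> forall f, P f.
Proof.
move=> P0 PD PZ PU f; rewrite [f]monalg.monalgE; apply: (big_ind P) => // x _.
have -> : monalg.mkmalgU x (monalg.mcoeff x f) = monalg.mcoeff x f *: << x >> :> monalg.malg T K.
  by apply/monalg.malgP => y; rewrite monalg.mcoeffZ !monalg.mcoeffU mulr_natr.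
exact: PZ.
Qed.

Section ToricFaceRing.
Context {R : realType} {X : choiceType} {S : conical_complex R X}.
Context (K : fieldType) (M : monoidal_complex S).

(* K[M]: the finitely supported functions |M| -> K, with the product below. *)
Definition toric_ring : Type := monalg.malg (msupport M) K.

HB.instance Definition _ := GRing.Lmodule.on toric_ring.

(* The basis element t^x for x in |M| (and 0 otherwise). *)
Definition tmon (x : X) : toric_ring :=
  if insub x is Some y then << (y : msupport M) >> else 0.

(* t^x t^y is t^(x+y) if x and y lie in a common monoid M_c, the sum being
   computed in M_c, and the default value 0 otherwise. *)
Definition tmon_mul (x y : msupport M) : toric_ring :=
  xget 0 [set f | exists c u v, [/\ faces S c, M c u, M c v,
    chart S c u = val x /\ chart S c v = val y & f = tmon (chart S c (u + v))]].

Definition toric_mul (f g : toric_ring) : toric_ring :=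
  \sum_(x <- monalg.msupp f) \sum_(y <- monalg.msupp g) (monalg.mcoeff x f * monalg.mcoeff y g) *: tmon_mul x y.

(* The unit element t^0; it is 0 when there is no face. *)
Definition toric_one : toric_ring :=
  xget 0 [set f | exists2 c, faces S c & f = tmon (chart S c 0)].

Lemma supportP (x : msupport M) : msupport M (val x).
Proof. exact: set_mem (valP x). Qed.

Lemma tmon_val (x : msupport M) : tmon (val x) = << x >>.
Proof. by rewrite /tmon valK. Qed.

Lemma tmon_support x : msupport M x -> exists2 y : msupport M, val y = x & tmon x = << y >>.
Proof.
move=> Mx; exists (exist _ x (mem_set Mx)) => //.
by rewrite -tmon_val.
Qed.

Lemma tmon_mulE c (x y : msupport M) : faces S c -> c (val x) -> c (val y) ->
  tmon_mul x y = tmon (add_in S c (val x) (val y)).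
Proof.
move=> Sc cx cy; have Mx := supportP x; have My := supportP y.
rewrite /tmon_mul; set P := (X in xget 0 X); suff H f : P f -> f = tmon (add_in S c (val x) (val y)).
  apply: H; apply: xgetPex; exists (tmon (add_in S c (val x) (val y))).
  exists c, (coord S c (val x)), (coord S c (val y)).
  have [_ Ex] := coord_spec Sc cx; have [_ Ey] := coord_spec Sc cy.
  by split=> //; exact: mon_coord.
move=> [d [u [v [Sd Mu Mv [ux vy] ->]]]]; congr tmon.
have [sub _ _] := mon_faceP M Sd.
have Cu := sub _ Mu; have Cv := sub _ Mv.
rewrite -(coordK Sd Cu) -(coordK Sd Cv) ux vy -/(add_in S d _ _).
by apply: add_in_indep => //; rewrite -?ux -?vy; exact: chart_face.
Qed.

Lemma tmon_mul_eq0 (x y : msupport M) :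
  ~ (exists c, [/\ faces S c, c (val x) & c (val y)]) -> tmon_mul x y = 0.
Proof.
move=> N; apply: xgetPN => f [c [u [v [Sc Mu Mv [ux vy] _]]]]; apply: N.
have [sub _ _] := mon_faceP M Sc.
by exists c; rewrite -ux -vy; split=> //; apply: chart_face => //; exact: sub.
Qed.

Lemma tmon_mulC x y : tmon_mul x y = tmon_mul y x.
Proof.
have [[c [Sc cx cy]]|N] := pselect (exists c, [/\ faces S c, c (val x) & c (val y)]).
  by rewrite !(tmon_mulE Sc)// add_inC.
by rewrite !tmon_mul_eq0// => -[c []] *; apply: N; exists c.
Qed.

Lemma toric_mulE f g :
  toric_mul f g = malg_ext (fun x => malg_ext (tmon_mul x) g) f.
Proof.
apply: eq_bigr => x _; rewrite scaler_sumr.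
by apply: eq_bigr => y _; rewrite scalerA.
Qed.

Lemma toric_mulC : commutative toric_mul.
Proof.
move=> f g; rewrite /toric_mul exchange_big; apply: eq_bigr => y _.
by apply: eq_bigr => x _; rewrite tmon_mulC mulrC.
Qed.

Lemma toric_mulDl : left_distributive toric_mul +%R.
Proof. by move=> f g h; rewrite !toric_mulE malg_extD. Qed.

Lemma toric_mulZl k f g : toric_mul (k *: f) g = k *: toric_mul f g.
Proof. by rewrite !toric_mulE malg_extZ. Qed.

Lemma toric_mulDr : right_distributive toric_mul +%R.
Proof. by move=> f g h; rewrite toric_mulC toric_mulDl !(toric_mulC f). Qed.

Lemma toric_mulZr k f g : toric_mul f (k *: g) = k *: toric_mul f g.
Proof. by rewrite toric_mulC toric_mulZl toric_mulC. Qed.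

Lemma toric_mul0l f : toric_mul 0 f = 0.
Proof. by rewrite toric_mulE malg_ext0. Qed.

Lemma toric_mul0r f : toric_mul f 0 = 0.
Proof. by rewrite toric_mulC toric_mul0l. Qed.

Lemma toric_mulUU (x y : msupport M) : toric_mul << x >> << y >> = tmon_mul x y.
Proof. by rewrite toric_mulE !malg_extU. Qed.

Lemma tmonM x y c : faces S c -> msupport M x -> msupport M y -> c x -> c y ->
  toric_mul (tmon x) (tmon y) = tmon (add_in S c x y).
Proof.
move=> Sc /tmon_support[x' <- ->] /tmon_support[y' <- ->] cx cy.
by rewrite toric_mulUU (tmon_mulE Sc).
Qed.

Lemma tmonM0 x y : msupport M x -> msupport M y ->
  ~ (exists c, [/\ faces S c, c x & c y]) -> toric_mul (tmon x) (tmon y) = 0.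
Proof.
move=> /tmon_support[x' <- ->] /tmon_support[y' <- ->] N.
by rewrite toric_mulUU tmon_mul_eq0.
Qed.

Lemma tmonMM x y z c : faces S c -> msupport M x -> msupport M y -> msupport M z ->
  c x -> c y -> c z ->
  toric_mul (toric_mul (tmon x) (tmon y)) (tmon z) =
  tmon (chart S c (coord S c x + coord S c y + coord S c z)).
Proof.
move=> Sc Mx My Mz cx cy cz; rewrite (tmonM Sc)// (tmonM Sc)//.
- by rewrite {1}/add_in coord_add_in.
- exact: add_in_support.
- exact: add_in_face.
Qed.

Lemma tmonMM0 x y z : msupport M x -> msupport M y -> msupport M z ->
  ~ (exists c, [/\ faces S c, c x, c y & c z]) ->
  toric_mul (toric_mul (tmon x) (tmon y)) (tmon z) = 0.
Proof.
move=> Mx My Mz N.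
have [[c [Sc cx cy]]|Nxy] := pselect (exists c, [/\ faces S c, c x & c y]); last first.
  by rewrite (tmonM0 Mx My Nxy) toric_mul0l.
rewrite (tmonM Sc)// tmonM0//; first exact: add_in_support.
move=> [d [Sd dxy dz]]; apply: N; exists d; split=> //.
  exact: add_in_extremal Sc Sd cx cy dxy.
by move: dxy; rewrite add_inC; exact: add_in_extremal.
Qed.

Lemma toric_mulA : associative toric_mul.
Proof.
move=> f g h; move: f; apply: malg_ind.
- by rewrite !toric_mul0l.
- by move=> f f' E E'; rewrite !toric_mulDl E E'.
- by move=> k f E; rewrite !toric_mulZl E.
move=> x; move: g; apply: malg_ind.
- by rewrite toric_mul0r !toric_mul0l toric_mul0r.
- by move=> f f' E E'; rewrite toric_mulDl !toric_mulDr toric_mulDl E E'.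
- by move=> k f E; rewrite toric_mulZl !toric_mulZr toric_mulZl E.
move=> y; move: h; apply: malg_ind.
- by rewrite !toric_mul0r.
- by move=> f f' E E'; rewrite !toric_mulDr E E'.
- by move=> k f E; rewrite !toric_mulZr E.
move=> z; rewrite -!tmon_val.
have Mx := supportP x; have My := supportP y; have Mz := supportP z.
rewrite [LHS]toric_mulC.
have [[c [Sc cx cy cz]]|N] := pselect
    (exists c, [/\ faces S c, c (val x), c (val y) & c (val z)]).
  by rewrite !(tmonMM Sc)// addrC addrA.
by rewrite !tmonMM0// => -[c []] *; apply: N; exists c.
Qed.

Lemma toric_oneE c : faces S c -> toric_one = tmon (chart S c 0).
Proof.
move=> Sc; have : exists f : toric_ring, exists2 c, faces S c & f = tmon (chart S c 0).
  by exists (tmon (chart S c 0)), c.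
by move=> /(xgetPex 0); rewrite -/toric_one => -[d Sd ->]; rewrite (chart0_indep Sd Sc).
Qed.

Lemma toric_mul1 : left_id toric_one toric_mul.
Proof.
apply: malg_ind.
- exact: toric_mul0r.
- by move=> f g Ef Eg; rewrite toric_mulDr Ef Eg.
- by move=> k f E; rewrite toric_mulZr E.
move=> x; have Mx := supportP x; have [c Sc [u Mu ux]] := Mx.
have [sub M0 _] := mon_faceP M Sc.
rewrite (toric_oneE Sc) -tmon_val (tmonM Sc)//.
- by rewrite /add_in coordK ?add0r -?ux ?coordK//; [exact: sub|exact: cone_face0].
- exact: mon_support.
- exact: face_zero.
- by rewrite -ux; apply: chart_face => //; exact: sub.
Qed.

HB.instance Definition _ := GRing.Zmodule_isComPzRing.Build toric_ring
  toric_mulA toric_mulC toric_mul1 toric_mulDl.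

Lemma toric_scalerAl (k : K) (f g : toric_ring) : k *: (f * g) = (k *: f) * g.
Proof. exact/esym/toric_mulZl. Qed.

Lemma toric_scalerAr (k : K) (f g : toric_ring) : k *: (f * g) = f * (k *: g).
Proof. exact/esym/toric_mulZr. Qed.

End ToricFaceRing.

Section PolynomialRing.
Context {K : fieldType} {n : nat}.
Implicit Types (p q : {mpoly K[n]}) (I : set {mpoly K[n]}).

Definition ideal_gen (A : set {mpoly K[n]}) : set {mpoly K[n]} :=
  [set p | exists2 s : seq ({mpoly K[n]} * {mpoly K[n]}),
     (forall x, x \in s -> A x.2) & p = \sum_(x <- s) x.1 * x.2].

Definition radical I : set {mpoly K[n]} :=
  [set p | exists k : nat, I (p ^+ k)].

Definition wdeg (w : 'I_n -> nat) (m : 'X_{1..n}) : nat :=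
  (\sum_(i < n) m i * w i)%N.

Lemma wdeg0 w : wdeg w 0%MM = 0%N.
Proof. by rewrite /wdeg big1// => i _; rewrite mnm0E. Qed.

Lemma wdegD w : {morph wdeg w : m1 m2 / (m1 + m2)%MM >-> (m1 + m2)%N}.
Proof.
move=> m1 m2; rewrite /wdeg -big_split /=.
by apply: eq_bigr => i _; rewrite mnmDE mulnDl.
Qed.

HB.instance Definition _ w := isMeasure.Build n (wdeg w) (wdeg0 w) (wdegD w).

(* The component of highest w-degree. *)
Definition initial_form (w : 'I_n -> nat) p : {mpoly K[n]} :=
  pihomog (wdeg w) (\max_(m <- msupp p) wdeg w m) p.

Definition initial_ideal (w : 'I_n -> nat) I : set {mpoly K[n]} :=
  ideal_gen (initial_form w @` I).

End PolynomialRing.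

Section ToricIdeals.
Context {R : realType} {X : choiceType} {S : conical_complex R X}.
Context (K : fieldType) (M : monoidal_complex S) {n : nat}.

Section Eval.
Variable t : 'I_n -> toric_ring K M.

(* The K-algebra homomorphism K[X_1, ..., X_n] -> K[M] with X_e |-> t e (mmap
   is not available since K[M] is the zero ring if there is no face). *)
Definition toric_eval (p : {mpoly K[n]}) : toric_ring K M :=
  \sum_(m <- msupp p) p@_m *: \prod_(i < n) t i ^+ m i.

Lemma toric_evalE p k : (msize p <= k)%N ->
  toric_eval p = \sum_(m : 'X_{1..n < k}) p@_m *: \prod_(i < n) t i ^+ m i.
Proof.
move=> le_pk; set I : subFinType _ := 'X_{1..n < k}.
rewrite /toric_eval (ssrcomplements.big_mksub I) ?msupp_uniq //=; first last.
  by move=> x /msize_mdeg_lt /leq_trans; apply.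
rewrite big_rmcond //= => j /memN_msupp_eq0 ->.
by rewrite scale0r.
Qed.

Lemma toric_eval_linear c p q :
  toric_eval (c *: p + q) = c *: toric_eval p + toric_eval q.
Proof.
pose k := maxn (msize (c *: p + q)) (maxn (msize p) (msize q)).
rewrite !(@toric_evalE _ k) ?leq_max ?leqnn ?orbT// scaler_sumr -big_split.
by apply: eq_bigr => m _; rewrite mcoeffD mcoeffZ scalerDl scalerA.
Qed.

Lemma toric_eval0 : toric_eval 0 = 0.
Proof. by rewrite /toric_eval msupp0 big_nil. Qed.

Lemma toric_evalXm m : toric_eval 'X_[m] = \prod_(i < n) t i ^+ m i.
Proof. by rewrite /toric_eval msuppX big_seq1 mcoeffX eqxx scale1r. Qed.

Lemma toric_evalX i : toric_eval 'X_i = t i.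
Proof.
rewrite toric_evalXm (bigD1 i)//= mnm1E eqxx expr1 big1 ?mulr1// => j ji.
by rewrite mnm1E eq_sym (negbTE ji) expr0.
Qed.

Lemma toric_eval1 : toric_eval 1 = 1.
Proof.
rewrite -mpolyX0 toric_evalXm big1// => i _.
by rewrite mnm0E expr0.
Qed.

Lemma toric_evalM p q : toric_eval (p * q) = toric_eval p * toric_eval q.
Proof.
have XM m1 m2 : toric_eval ('X_[m1] * 'X_[m2]) =
    toric_eval 'X_[m1] * toric_eval 'X_[m2].
  rewrite -mpolyXD !toric_evalXm -big_split.
  by apply: eq_bigr => i _; rewrite mnmDE exprD.
have XP m : toric_eval ('X_[m] * q) = toric_eval 'X_[m] * toric_eval q.
  elim/mpolyind: q => [|d m' q _ _ IHq].
    by rewrite mulr0 toric_eval0 mulr0.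
  rewrite mulrDr -scalerAr !toric_eval_linear IHq mulrDr XM.
  by rewrite -toric_scalerAr.
elim/mpolyind: p => [|c m p _ _ IHp]; first by rewrite mul0r toric_eval0 mul0r.
by rewrite mulrDl -scalerAl !toric_eval_linear IHp mulrDl -toric_scalerAl XP.
Qed.

End Eval.

End ToricIdeals.

(* The ideal I_M: the kernel of X_e |-> t^(a_e). *)
Definition toric_ideal {R : realType} {X : choiceType}
    {S : conical_complex R X} (K : fieldType) (M : monoidal_complex S)
    {n : nat} (a : 'I_n -> X) : set {mpoly K[n]} :=
  [set p | toric_eval (fun e => tmon K M (a e)) p = 0].

(* The ideal J_(M_w): the kernel of X_e |-> t^(a_e) or 0. *)
Definition weighted_ideal {R : realType} {X : choiceType}
    {S : conical_complex R X} (K : fieldType) (M : monoidal_complex S)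
    {n : nat} (a : 'I_n -> X) (aM : forall e, msupport M (a e))
    (w : 'I_n -> nat) : set {mpoly K[n]} :=
  let Mw := weighted_complex M aM w in
  [set p | toric_eval (fun e =>
     if ht S a w (a e) == (w e)%:R then tmon K Mw (a e) else 0) p = 0].

Arguments toric_ideal {R X S} K M {n} a p.
Arguments weighted_ideal {R X S} K M {n} {a} aM w p.

(* Main.v *)
(* A monomial X^m whose variables lie in a common face c of Sigma has a value
   x = sum m_e a_e and a point z = sum m_e (a_e, w_e) of C'_c over x.  Farkas'
   lemma over the rationals gives a dichotomy: either some power X^(km) has the
   same value as a monomial X^m' of strictly smaller weight, in which case X^m
   is called reducible and lies in the radical of in_w(I_M), or a linear form
   that is nonnegative on C'_c vanishes at z and cuts out a face of the bottom,
   in which case X^m maps to t^x in K[M_w].  Reducible monomials, and those supported in no face, map to 0 in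
   K[M_w].

   Both inclusions then reduce to monomials by means of linear maps on toric face
   rings: for f in I_M of w-degree k, the map K[M] -> K[M_w] which keeps t^x when
   x is the value of an irreducible monomial of weight k sends the image of f to
   the image of in_w(f), so in_w(I_M) is contained in J, and J is radical because
   K[M_w] is reduced.  Conversely, the map K[M_w] -> S which sends t^x to an
   irreducible monomial of value x writes an element of J as a combination of
   monomials mapping to 0 and of w-homogeneous binomials in I_M. *)
From mathcomp Require Import all_boot all_order all_algebra.
From mathcomp Require Import finmap.
From mathcomp Require Import -(notations) monalg.
From mathcomp Require Import mpoly ring lra.
From mathcomp Require Import boolp classical_sets reals.
(* last, so that [coord] is not the one of vector.v *)
Require Import Defs.

Set Implicit Arguments.
Unset Strict Implicit.
Unset Printing Implicit Defensive.

Import Order.TTheory GRing.Theory Num.Theory.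

Local Open Scope classical_set_scope.
Local Open Scope ring_scope.

(** * Farkas' lemma and common denominators *)

(* Induction on [r]: a form [u] that separates [b] from the tail but not from
   [g j] is corrected by projecting along [g j] onto the kernel of [u]. *)
Lemma farkas (F : realFieldType) (n : nat) (I : eqType) (r : seq I)
    (g : I -> 'rV[F]_n) (b : 'rV[F]_n) : uniq r ->
  (exists2 l : I -> F, (forall i, 0 <= l i) & b = \sum_(i <- r) l i *: g i) \/
  (exists2 u : 'cV[F]_n, (forall i, i \in r -> 0 <= (g i *m u) 0 0) &
     (b *m u) 0 0 < 0).
Proof.
elim: r g b => [|j r IH] g b /=.
  move=> _; have [->|b0] := eqVneq b 0.
    by left; exists (fun=> 0) => //; rewrite big_nil.
  right; exists (- b^T) => //; rewrite mulmxN mxE oppr_lt0 mxE.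
  under eq_bigr do rewrite mxE -expr2.
  have [k bk] : exists k, b 0 k != 0.
    apply/existsP; apply: contraNT b0; rewrite negb_exists => /forallP H.
    by apply/eqP/rowP => k; rewrite mxE; apply/eqP; rewrite -[_ == _]negbK.
  rewrite (bigD1 k)//= ltr_pwDl ?sumr_ge0// => [|i _]; rewrite ?sqr_ge0//.
  by rewrite exprn_even_gt0.
move=> /andP[jr ur].
have [[l l0 ->]|[u u0 bu]] := IH g b ur.
  left; exists (fun i => if i == j then 0 else l i) => [i|].
    by case: ifP.
  rewrite big_cons eqxx scale0r add0r; apply: eq_big_seq => i ir.
  by case: eqP ir jr => // -> ->.
have [gju|gju] := leP 0 ((g j *m u) 0 0).
  by right; exists u => // i; rewrite inE => /orP[/eqP->|/u0].
pose al (v : 'rV[F]_n) : F := (v *m u) 0 0 / (g j *m u) 0 0.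
pose pr (v : 'rV[F]_n) := v - al v *: g j.
have [[l l0 bE]|[y y0 byl]] := IH (pr \o g) (pr b) ur.
  left; exists (fun i => if i == j then al b - \sum_(i <- r) l i * al (g i) else l i).
    (* The coefficient of [g j] is nonnegative: [al b] is a quotient of two negative numbers, while
       each [al (g i)] is at most 0 because [u] is nonnegative on the tail. *)
    move=> i; case: ifP => // _; rewrite subr_ge0 (@le_trans _ _ 0)//; last first.
      by rewrite /al mulr_le0 ?ltW// invr_lt0.
    rewrite big_seq_cond sumr_le0// => k /andP[kr _].
    by rewrite mulr_ge0_le0// /al mulr_ge0_le0 ?u0// ltW// invr_lt0.
  rewrite big_cons eqxx.
  rewrite (eq_big_seq (fun i => l i *: g i)); last first.
    by move=> i ir; case: eqP ir jr => // -> ->.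
  move/eqP: bE; rewrite {1}/pr subr_eq => /eqP {1}->.
  rewrite (eq_bigr (fun i => l i *: g i - (l i * al (g i)) *: g j)); last first.
    by move=> i _; rewrite /= /pr scalerBr scalerA.
  by rewrite sumrB -scaler_suml scalerBl [RHS]addrC [RHS]addrA addrAC.
(* Transposing the projection [pr] turns [y] into a form on the whole space that vanishes on
   [g j]. *)
have prE (v : 'rV[F]_n) : (pr v *m y) 0 0 = (v *m (y - ((g j *m y) 0 0 / (g j *m u) 0 0) *: u)) 0 0.
  have BZ (x z : 'M[F]_1) k : (x - k *: z) 0 0 = x 0 0 - k * z 0 0 by rewrite !mxE.
  rewrite /pr mulmxBl mulmxBr -scalemxAl -scalemxAr !BZ; congr (_ - _).
  by rewrite /al mulrAC [RHS]mulrAC; congr (_ / _); exact: mulrC.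
right; exists (y - ((g j *m y) 0 0 / (g j *m u) 0 0) *: u); last by rewrite -prE.
move=> i; rewrite -prE inE => /orP[/eqP->|/y0//].
by rewrite /pr /al divff ?lt_eqF// scale1r subrr mul0mx mxE.
Qed.

Lemma common_denominator (I : finType) (l : I -> rat) : (forall i, 0 <= l i) ->
  exists k (L : I -> nat), (0 < k)%N /\ forall i, (L i)%:R = k%:R * l i.
Proof.
move=> l0; exists (\prod_i `|denq (l i)|)%N.
exists (fun i => `|numq (l i)| * \prod_(j | j != i) `|denq (l j)|)%N; split.
  by rewrite prodn_gt0// => i; rewrite absz_gt0 denq_neq0.
move=> i; rewrite [in RHS](bigD1 i)//= !natrM mulrAC; congr (_ * _).
rewrite -{3}(divq_num_den (l i)) !natr_absz !ger0_norm ?numq_ge0 ?denq_ge0//.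
by rewrite mulrC divfK// intr_eq0 denq_neq0.
Qed.

(** * Values and weights of monomials, and the dichotomy *)

Section MonomialValues.
Context {R : realType} {X : choiceType} {n : nat}.
Implicit Types (S D : conical_complex R X) (a : 'I_n -> X) (m : 'X_{1..n}).
Implicit Types (c d : set X).

Definition supp_in a c m := forall i, m i != 0%N -> c (a i).

Definition msum S a c m : 'rV[R]_(cdim S c) := \sum_i coord S c (a i) *+ m i.

(** A relation rather than a function, since a monomial whose variables lie in no common face has no
    value. Uniqueness is [mval_inj]. *)
Definition mval S a m (x : X) :=
  exists2 c, faces S c & supp_in a c m /\ x = chart S c (msum S a c m).

(** Representing the same point is a relation between coordinates that holds at 0 and is preserved
    by addition, so it passes to the sums. With [D = S] it gives independence of the face; with [D]
    the subdivision it compares sums in $\Gamma_w$ and in $\Sigma$. *)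
Lemma chart_msum_transfer D S a c d m : faces D d -> faces S c ->
  chart D d 0 = chart S c 0 ->
  (forall x y, d x -> d y -> c x -> c y -> add_in D d x y = add_in S c x y) ->
  supp_in a d m -> supp_in a c m ->
  cone D d (msum D a d m) /\ cone S c (msum S a c m) /\
  chart D d (msum D a d m) = chart S c (msum S a c m).
Proof.
move=> Dd Sc E0 EA sd sc.
pose rl (u : 'rV[R]_(cdim D d)) (v : 'rV[R]_(cdim S c)) :=
  cone D d u /\ cone S c v /\ chart D d u = chart S c v.
have rl0 : rl 0 0 by split; [exact: cone_face0|split=> //; exact: cone_face0].
have rlD u v u' v' : rl u v -> rl u' v' -> rl (u + u') (v + v').
  move=> [Cu [Cv E]] [Cu' [Cv' E']].
  split; first exact: cone_faceD.
  split; first exact: cone_faceD.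
  have := EA (chart D d u) (chart D d u'); rewrite /add_in !coordK//.
  rewrite E E' !coordK//; apply; rewrite -?E -?E'; try exact: chart_face.
  by rewrite E; exact: chart_face.
  by rewrite E'; exact: chart_face.
suff : rl (msum D a d m) (msum S a c m) by [].
apply: big_ind2 => // i _.
have [->|mi] := eqVneq (m i) 0%N; first by rewrite !mulr0n.
elim: (m i) => [|k IH]; first by rewrite !mulr0n.
rewrite !mulrS; apply: rlD => //.
have [Cu Eu] := coord_spec Dd (sd i mi); have [Cv Ev] := coord_spec Sc (sc i mi).
by split=> //; split=> //; rewrite Eu Ev.
Qed.

Section OneComplex.
Variables (S : conical_complex R X) (a : 'I_n -> X).
Local Notation supp_in := (supp_in a).
Local Notation msum := (msum S a).
Local Notation mval := (mval S a).

Lemma cone_msum c m : faces S c -> supp_in c m -> cone S c (msum c m).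
Proof.
move=> Sc sc.
by have [] := chart_msum_transfer Sc Sc erefl (fun _ _ _ _ _ _ => erefl) sc sc.
Qed.

Lemma msum_indep c d m : faces S c -> faces S d -> supp_in c m -> supp_in d m ->
  chart S c (msum c m) = chart S d (msum d m).
Proof.
move=> Sc Sd sc sd; have [|x y cx cy dx dy|_ []//] :=
  chart_msum_transfer Sc Sd _ _ sc sd; first exact: chart0_indep.
exact: add_in_indep.
Qed.

(** The overlap with [d] is a face of the cone of [c], hence extremal: splitting off one summand
    [a i] of the sum shows that [a i] lies in it. *)
Lemma msum_extremal c d m : faces S c -> faces S d -> supp_in c m ->
  d (chart S c (msum c m)) -> supp_in d m.
Proof.
move=> Sc Sd sc dm i mi.
have [Ci Ei] := coord_spec Sc (sc i mi); have [fO _] := overlapP Sc Sd.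
pose m' := (m - U_(i))%MM.
have mE : msum c m = coord S c (a i) + msum c m'.
  rewrite /msum (bigD1 i)//= [in RHS](bigD1 i)//= addrA; congr (_ + _).
    by rewrite mnmBE mnm1E eqxx -mulrS subn1 prednK// lt0n.
  apply: eq_bigr => j ji; rewrite mnmBE mnm1E eq_sym (negbTE ji) subn0.
  by [].
have Cm' : cone S c (msum c m').
  by apply: cone_msum => // j; rewrite mnmBE => mj; apply: sc; apply: contraNneq mj => ->.
have O : overlap S c d (coord S c (a i) + msum c m').
  by split; [exact: cone_faceD|rewrite -mE].
by have [] := face_extremal fO Ci Cm' O; rewrite Ei.
Qed.

Lemma mvalP m x d : mval m x -> faces S d -> d x ->
  supp_in d m /\ chart S d (msum d m) = x.
Proof.
move=> [c Sc [sc ->]] Sd dx; have sd := msum_extremal Sc Sd sc dx.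
by split=> //; exact: msum_indep.
Qed.

Lemma mval_face m x : mval m x -> exists2 c, faces S c & c x.
Proof.
by move=> [c Sc [sc ->]]; exists c => //; apply: chart_face => //; exact: cone_msum.
Qed.

Lemma mval_inj m x y : mval m x -> mval m y -> x = y.
Proof. by move=> [c Sc [sc ->]] [d Sd [sd ->]]; exact: msum_indep. Qed.

Lemma msum_mul c m k : msum c (m *+ k)%MM = msum c m *+ k.
Proof. by rewrite /msum -sumrMnl; apply: eq_bigr => i _; rewrite mulmnE mulrnA. Qed.

Lemma supp_in_mul c m k : supp_in c m -> supp_in c (m *+ k)%MM.
Proof. by move=> sc i; rewrite mulmnE muln_eq0 negb_or => /andP[/sc]. Qed.

Lemma supp_in_mulI c m k : (0 < k)%N -> supp_in c (m *+ k)%MM -> supp_in c m.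
Proof. by move=> k0 sc i mi; apply: sc; rewrite mulmnE muln_eq0 negb_or mi -lt0n. Qed.

Variable w : 'I_n -> nat.

(** Powers are allowed because Farkas' lemma yields rational coefficients, whose denominators must
    be cleared; this is where the radical enters. The strict inequality forces [k] to be
    positive. *)
Definition reducible m := exists k m' x,
  [/\ mval (m *+ k)%MM x, mval m' x & (wdeg w m' < k * wdeg w m)%N].

Lemma irreducible_min m m' x : ~ reducible m -> mval m x -> mval m' x ->
  (wdeg w m <= wdeg w m')%N.
Proof.
move=> rm mx mx'; rewrite leqNgt; apply/negP => lt; apply: rm.
by exists 1%N, m', x; rewrite mul1n.
Qed.

(** Monomials of the same value have the same sum in a common face, so their [k]-th powers also have
    equal values and the same witnesses serve. *)
Lemma reducible_mval m m' x : mval m x -> mval m' x -> wdeg w m = wdeg w m' ->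
  reducible m -> reducible m'.
Proof.
move=> mx mx' E [k [m1 [y [my m1y lt]]]]; exists k, m1, y; split=> //; last by rewrite -E.
have k0 : (0 < k)%N by case: k lt {my}; rewrite ?mul0n.
have [d Sd dy] := mval_face my; have [sd yE] := mvalP my Sd dy.
have sm := supp_in_mulI k0 sd.
have dx : d x.
  have -> : x = chart S d (msum d m) by apply: mval_inj mx _; exists d.
  by apply: chart_face => //; exact: cone_msum.
have [_ xE] := mvalP mx Sd dx; have [sm' xE'] := mvalP mx' Sd dx.
exists d => //; split; first exact: supp_in_mul.
rewrite -yE !msum_mul; congr (chart S d (_ *+ k)).
by apply: (chart_inj Sd); rewrite ?xE ?xE'//; exact: cone_msum.
Qed.

Lemma sum_lift_pt c m :
  \sum_i lift_pt (coord S c (a i)) (w i)%:R *+ m i =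
  lift_pt (msum c m) (wdeg w m)%:R.
Proof.
rewrite /msum /wdeg natr_sum.
rewrite [RHS](_ : _ = \sum_i lift_pt (coord S c (a i) *+ m i) (m i * w i)%:R).
  apply: eq_bigr => i _.
  by rewrite -!scaler_nat lift_ptZ natrM.
apply: (big_rec3 (fun x y z => lift_pt x y = z)) => [|i u v z _ <-].
  by rewrite /lift_pt raddf0 row_mx0.
by rewrite lift_ptD.
Qed.

Lemma lift_cone_msum c m : faces S c -> supp_in c m ->
  lift_cone S a w c (lift_pt (msum c m) (wdeg w m)%:R).
Proof.
move=> Sc sc; rewrite -sum_lift_pt.
apply: (big_ind (lift_cone S a w c)) => [||i _]; [exact: cone_hull0|exact: cone_hullD|].
have [->|mi] := eqVneq (m i) 0%N; first by rewrite mulr0n; exact: cone_hull0.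
rewrite -scaler_nat; apply: cone_hullZ => //; apply: sub_cone_hull.
have [Ci Ei] := coord_spec Sc (sc i mi).
by exists (coord S c (a i)), i.
Qed.

(** A witness of reducibility, divided by [k], is a point of $C'_c$ over the value of [m] at height
    below [wdeg w m]. *)
Lemma lbound_irreducible c m : faces S c -> supp_in c m ->
  lbound [set h | lift_cone S a w c (lift_pt (msum c m) h)] (wdeg w m)%:R ->
  ~ reducible m.
Proof.
move=> Sc sc lb [k [m' [x [mx mx' lt]]]].
have k0 : (0 < k)%N by case: k lt {mx}; rewrite ?mul0n.
have xE : x = chart S c (msum c (m *+ k)%MM).
  by apply: mval_inj mx _; exists c => //; split=> //; exact: supp_in_mul.
have Ck : cone S c (msum c (m *+ k)%MM) by apply: cone_msum => //; exact: supp_in_mul.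
have cx : c x by rewrite xE; exact: chart_face.
have [sm' xE'] := mvalP mx' Sc cx.
have E : msum c m' = msum c m *+ k.
  by rewrite -msum_mul; apply: (chart_inj Sc); rewrite ?xE' ?xE//; exact: cone_msum.
have k1 : k%:R != 0 :> R by rewrite pnatr_eq0 -lt0n.
have ki0 : 0 <= k%:R^-1 :> R by rewrite invr_ge0.
have := cone_hullZ ki0 (lift_cone_msum Sc sm').
rewrite lift_ptZ E -scaler_nat scalerA mulVf// scale1r => /lb.
rewrite -(ler_pM2l (x := k%:R)) ?ltr0n// mulrA divff// mul1r -natrM ler_nat.
by rewrite leqNgt lt.
Qed.

Lemma height_ge0 c z : lift_cone S a w c z -> 0 <= height z.
Proof.
move: z; apply: cone_ind => [|r x v r0 [y [e [_ _ ->]]] _ v0].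
  by rewrite /height !mxE.
rewrite -[v]lift_ptE lift_ptZ lift_ptD height_lift.
by rewrite addr_ge0// mulr_ge0.
Qed.

Hypothesis coord_int : forall c i, faces S c -> c (a i) -> integral (coord S c (a i)).

(** Farkas' lemma asks whether the downward vertical vector lies in the cone generated by the
    $(a_i,w_i)$ and $-z$, where $z$ is the lifted point of [m]. If so, [m] is reducible; if not, the
    separating form cuts out the face. *)
Lemma irreducible_face c m : faces S c -> supp_in c m -> ~ reducible m ->
  exists2 F, bottom_face S a w c F &
    forall i, m i != 0%N -> F (lift_pt (coord S c (a i)) (w i)%:R).
Proof.
move=> Sc sc nred.
(* By integrality the floors are the coordinates themselves, so Farkas' lemma can be applied over
   the rationals. *)
pose V i : 'rV[rat]_(cdim S c + 1) :=
  row_mx (\row_j (Num.floor (coord S c (a i) 0 j))%:~R) ((w i)%:R)%:M.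
have VE i : c (a i) -> map_mx ratr (V i) = lift_pt (coord S c (a i)) (w i)%:R :> 'rV[R]__.
  move=> ci; rewrite /V map_row_mx map_scalar_mx /= ratr_nat /lift_pt; congr row_mx.
  by apply/rowP => j; rewrite !mxE ratr_int floorK// coord_int.
pose z := \sum_i V i *+ m i.
have zE : map_mx ratr z = lift_pt (msum c m) (wdeg w m)%:R :> 'rV[R]__.
  rewrite -sum_lift_pt /z raddf_sum; apply: eq_bigr => i _; rewrite raddfMn /=.
  have [->|mi] := eqVneq (m i) 0%N; first by rewrite !mulr0n.
  by rewrite VE//; exact: sc.
pose g (o : option 'I_n) := if o is Some i then V i else - z.
pose r := None :: [seq Some i | i <- enum 'I_n & `[<c (a i)>]].
have ur : uniq r.
  rewrite /= map_inj_uniq => [|i j []//]; apply/andP; split.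
    by apply/negP => /mapP[].
  by apply: filter_uniq; exact: enum_uniq.
have [[l l0 E]|[u u0 bu]] := farkas g (row_mx 0 (-1)%:M) ur; last first.
  pose U : 'cV[R]_(cdim S c + 1) := map_mx ratr u.
  have UE v : dotv (map_mx ratr v) U = ratr ((v *m u) 0 0).
    by rewrite /dotv /U -map_mxM mxE.
  have U0 v : lift_cone S a w c v -> 0 <= dotv v U.
    move: v; apply: cone_ind => [|t _ v t0 [y [e [Cy ye ->]]] _ v0]; first by rewrite dotv0l.
    rewrite dotvD dotvZ addr_ge0// mulr_ge0//.
    have ce : c (a e) by rewrite -ye; exact: chart_face.
    rewrite -(coordK Sc Cy) ye -VE// UE ler0q (u0 (Some e))//.
    by rewrite inE /= map_f// mem_filter mem_enum andbT; exact/asboolP.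
  (* The form is nonnegative at $z$, a point of $C'_c$, and at the generator $-z$. *)
  have Uz : dotv (lift_pt (msum c m) (wdeg w m)%:R) U = 0.
    apply/eqP; rewrite eq_le U0 ?andbT; last exact: lift_cone_msum.
    rewrite -zE UE lerq0 -oppr_ge0.
    by have := u0 None; rewrite inE eqxx mulNmx mxE; exact.
  (* The form is positive on the upward direction, so below one of its zeros it is negative and
     $C'_c$ has no points: its zeros in $C'_c$ lie in the bottom. *)
  pose tp : 'rV[R]_(cdim S c + 1) := lift_pt 0 1.
  have Utp : 0 < dotv tp U.
    rewrite -oppr_lt0 -mulN1r -dotvZ /tp lift_ptZ mulr1 scaler0.
    rewrite (_ : lift_pt _ _ = map_mx ratr (row_mx 0 (-1)%:M)) ?UE ?ltrq0//.
    by rewrite map_row_mx map_mx0 map_scalar_mx /= rmorphN1.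
  exists (lift_cone S a w c `&` [set v | dotv v U = 0]); last first.
    move=> i mi; have [Ci Ei] := coord_spec Sc (sc i mi).
    have mem j : m j != 0%N -> lift_cone S a w c (lift_pt (coord S c (a j)) (w j)%:R).
      move=> mj; have [Cj Ej] := coord_spec Sc (sc j mj).
      by apply: sub_cone_hull; exists (coord S c (a j)), j.
    split; first exact: mem.
    (* A vanishing sum of nonnegative terms has only zero terms. *)
    move: Uz; rewrite -sum_lift_pt.
    have dsum (f : 'I_n -> 'rV[R]_(cdim S c + 1)) : dotv (\sum_i f i *+ m i) U =
        \sum_i dotv (f i) U *+ m i.
      apply: (big_ind2 (fun x y => dotv x U = y)) => [|x y x' y' <- <-|j _].
      - exact: dotv0l.
      - exact: dotvD.
      - by rewrite -scaler_nat dotvZ mulr_natl.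
    rewrite dsum => /eqP; rewrite psumr_eq0; last first.
      move=> j _; have [->|mj] := eqVneq (m j) 0%N; first by rewrite mulr0n.
      by rewrite mulrn_wge0// U0//; exact: mem.
    move=> /allP/(_ i (mem_index_enum _)) /=.
    by rewrite mulrn_eq0 (negbTE mi) => /eqP.
  split; first by apply/faceP; exists U.
  move=> v [Cv /= v0]; exists (lsubmx v), (height v); split; first by rewrite lift_ptE.
  split; first by rewrite /= lift_ptE.
  move=> h /= /U0.
  have -> : lift_pt (lsubmx v) h = v + (h - height v) *: tp.
    by rewrite -{2}(lift_ptE v) /tp lift_ptZ lift_ptD scaler0 addr0 mulr1 addrCA subrr addr0.
  by rewrite dotvD v0 add0r dotvZ pmulr_lge0// subr_ge0.
exfalso; apply: nred.
(* After clearing denominators, the coefficient of $-z$ becomes the power [L None] of $X^m$, and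
   those of the [V i] become the exponents of [m']. The weight drops by exactly [k]. *)
have [k [L [k0 LE]]] := common_denominator l0.
pose m' : 'X_{1..n} := [multinom (if `[<c (a i)>] then L (Some i) else 0)%N | i < n].
have sm' : supp_in c m'.
  by move=> i; rewrite mnmE; case: asboolP.
have m'E : \sum_(i <- enum 'I_n | `[<c (a i)>]) (L (Some i))%:R *: V i =
    \sum_i V i *+ m' i.
  rewrite big_enum_cond big_mkcond; apply: eq_bigr => i _; rewrite mnmE.
  by rewrite /=; case: asboolP; rewrite ?mulr0n// scaler_nat.
have : k%:R *: row_mx 0 (-1)%:M = \sum_i V i *+ m' i - z *+ L None.
  rewrite E big_cons big_map big_filter scalerDr scaler_sumr -m'E addrC; congr (_ + _).
    by apply: eq_bigr => i _; rewrite scalerA -LE.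
  by rewrite scalerA -LE scalerN scaler_nat.
move=> /(congr1 (map_mx (ratr : rat -> R))).
rewrite map_mxZ /= ratr_nat map_row_mx map_mx0 map_scalar_mx /= rmorphN1.
rewrite map_mxB raddfMn /= zE raddf_sum.
rewrite (eq_bigr (fun i => lift_pt (coord S c (a i)) (w i)%:R *+ m' i)); last first.
  move=> i _; rewrite raddfMn /=.
  have [->|mi] := eqVneq (m' i) 0%N; first by rewrite !mulr0n.
  by rewrite VE//; exact: sm'.
rewrite sum_lift_pt -[row_mx _ _]/(lift_pt 0 (-1)) lift_ptZ scaler0 mulrN1.
rewrite -scaler_nat -scaleNr lift_ptZ lift_ptD scaleNr scaler_nat mulNr -natrM.
move=> E'.
have /esym/eqP := congr1 (fun x => lsubmx x) E'.
rewrite !lift_ptK subr_eq0 => /eqP E1.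
have := congr1 (fun x => height x) E'; rewrite !height_lift => /eqP.
rewrite eq_sym subr_eq addrC -subr_eq opprK -natrD eqr_nat => /eqP E2.
exists (L None), m', (chart S c (msum c m')); split.
- exists c => //; split; first exact: supp_in_mul.
  by rewrite msum_mul E1.
- by exists c.
- by rewrite -E2 -addn1 leq_add2l.
Qed.

End OneComplex.
End MonomialValues.

(** * Products of basis elements in a toric face ring *)

Section ToricMonomials.
Context {R : realType} {X : choiceType} {S : conical_complex R X}.
Context (K : fieldType) (M : monoidal_complex S) {n : nat} (a : 'I_n -> X).
Local Notation T := (toric_ring K M).
Implicit Types (t : 'I_n -> T) (m : 'X_{1..n}) (f g : T).

(** The values of [t] are prescribed only on the variables of [m], so that this also serves for
    $K[\mathcal{M}_w]$, where some variables are sent to 0. *)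
Lemma prod_tmon t m c : faces S c ->
  (forall i, m i != 0%N -> [/\ c (a i), msupport M (a i) & t i = tmon K M (a i)]) ->
  M c (msum S a c m) /\
  \prod_(i < n) t i ^+ m i = tmon K M (chart S c (msum S a c m)).
Proof.
move=> Sc H; have [sub M0 MD] := mon_faceP M Sc.
pose rl f v := M c v /\ f = tmon K M (chart S c v).
have rl0 : rl 1 0 by split=> //; exact: toric_oneE.
have rlM f u g v : rl f u -> rl g v -> rl (f * g) (u + v).
  move=> [Mu ->] [Mv ->]; split; first exact: MD.
  have Cu := sub _ Mu; have Cv := sub _ Mv.
  rewrite [LHS](tmonM K Sc) /add_in ?coordK//; try exact: mon_support.
    exact: chart_face.
  exact: chart_face.
suff : rl (\prod_(i < n) t i ^+ m i) (msum S a c m) by [].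
apply: big_ind2 => // i _.
have [->|mi] := eqVneq (m i) 0%N; first by rewrite mulr0n expr0.
have [ci Mi ->] := H i mi.
elim: (m i) => [|k IH]; first by rewrite mulr0n expr0.
rewrite exprS mulrS; apply: rlM => //; split; first exact: mon_coord.
by have [_ ->] := coord_spec Sc ci.
Qed.

Lemma prod_tmon_neq0 t m :
  (forall i, m i != 0%N -> msupport M (a i) /\ t i = tmon K M (a i)) ->
  \prod_(i < n) t i ^+ m i != 0 -> exists2 c, faces S c & supp_in a c m.
Proof.
move=> H.
(* Since faces are extremal, [vis] is multiplicative in [f]. *)
pose vis f (P : set X -> Prop) := f != 0 ->
  exists x, [/\ msupport M x, f = tmon K M x & forall d, faces S d -> d x -> P d].
have vis1 : vis 1 (fun=> True).
  move=> f0; have [[c Sc]|N] := pselect (exists c, faces S c).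
    have [_ M0 _] := mon_faceP M Sc; exists (chart S c 0); split=> //.
      exact: mon_support.
    exact: toric_oneE.
  (* Without a face, the unit is the default value 0. *)
  case/eqP: f0; apply: xgetPN => g [c Sc _].
  by apply: N; exists c.
have visM f g P Q : vis f P -> vis g Q -> vis (f * g) (fun d => P d /\ Q d).
  move=> vf vg fg; have f0 : f != 0 by apply: contraNneq fg => ->; rewrite mul0r.
  have g0 : g != 0 by apply: contraNneq fg => ->; rewrite mulr0.
  have [x [Mx fE Px]] := vf f0; have [y [My gE Qy]] := vg g0.
  have [[c [Sc cx cy]]|N] := pselect (exists c, [/\ faces S c, c x & c y]); last first.
    by case/eqP: fg; rewrite fE gE; exact: tmonM0.
  exists (add_in S c x y); split.
  - exact: add_in_support.
  - by rewrite fE gE; exact: tmonM.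
  - move=> d Sd dxy; split; first by apply: Px => //; exact: (add_in_extremal Sc Sd cx cy).
    by apply: Qy => //; apply: (add_in_extremal Sc Sd cy cx); rewrite add_inC.
have visW f P Q : vis f P -> (forall d, P d -> Q d) -> vis f Q.
  move=> vf PQ /vf[x [Mx fE Px]]; exists x; split=> // d Sd /(Px d Sd); exact: PQ.
have visX i : vis (t i ^+ m i) (fun d => m i != 0%N -> d (a i)).
  have [->|mi] := eqVneq (m i) 0%N; first exact: visW vis1 _.
  have [Mi ->] := H i mi.
  have vi : vis (tmon K M (a i)) (fun d => d (a i)) by exists (a i); split.
  case: (m i) mi => // k _; elim: k => [|k IH]; first by rewrite expr1; exact: visW vi _.
  by rewrite exprS; apply: visW (visM _ _ _ _ vi IH) _ => d [].
have visP (r : seq 'I_n) : vis (\prod_(i <- r) t i ^+ m i)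
    (fun d => forall i, i \in r -> m i != 0%N -> d (a i)).
  elim: r => [|i r IH]; first by rewrite big_nil; exact: visW vis1 _.
  rewrite big_cons; apply: visW (visM _ _ _ _ (visX i) IH) _ => d [di dr] j.
  by rewrite inE => /orP[/eqP->|/dr].
move=> /visP[x [[c Sc [v Mv vx]] _ P]].
exists c => // i mi; apply: (P c Sc) => //; last exact: mem_index_enum.
by rewrite -vx; apply: chart_face => //; have [sub _ _] := mon_faceP M Sc; exact: sub.
Qed.

End ToricMonomials.

(** * Toric face rings are reduced *)

Lemma seq_argmax {d} (T : eqType) (L : orderType d) (N : T -> L) (P : T -> Prop)
    (s : seq T) x0 : x0 \in s -> P x0 ->
  exists x, [/\ x \in s, P x & forall y, y \in s -> P y -> (N y <= N x)%O].
Proof.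
move=> x0s Px0; have s0 : x0 \in [seq x <- s | `[<P x>]].
  by rewrite mem_filter x0s andbT; exact/asboolP.
have [x] : exists2 x, x \in [seq x <- s | `[<P x>]] &
    forall y, y \in [seq x <- s | `[<P x>]] -> (N y <= N x)%O.
  clear x0s Px0; elim: [seq x <- s | `[<P x>]] x0 s0 => // z r IH _ _.
  case: r IH => [_|z' r /(_ z' (mem_head _ _))[x xr xM]].
    by exists z; rewrite ?mem_head// => y; rewrite inE => /eqP->.
  have [zx|xz] := leP (N z) (N x).
    by exists x => [|y]; rewrite in_cons ?xr ?orbT// => /orP[/eqP->|/xM].
  exists z => [|y]; rewrite in_cons ?eqxx// => /orP[/eqP->//|/xM yx].
  exact: le_trans yx (ltW xz).
rewrite mem_filter => /andP[/asboolP Px xs] xM; exists x; split=> // y ys Py.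
by apply: xM; rewrite mem_filter ys andbT; exact/asboolP.
Qed.

(** By the parallelogram law $|u-x|^2=(|u|^2+|v|^2)/2-|x|^2$ when $x$ is the midpoint of $u$ and
    $v$; the right side is at most 0. *)
Lemma norm_midpoint (R : realType) (k : nat) (u v x : 'rV[R]_k) :
  u + v = x + x -> \sum_j u 0 j ^+ 2 <= \sum_j x 0 j ^+ 2 ->
  \sum_j v 0 j ^+ 2 <= \sum_j x 0 j ^+ 2 -> u = x.
Proof.
move=> uv ux vx.
have E j : (u 0 j - x 0 j) ^+ 2 = 2^-1 * (u 0 j ^+ 2 + v 0 j ^+ 2) - x 0 j ^+ 2.
  have -> : v 0 j = x 0 j + x 0 j - u 0 j.
    by have /rowP/(_ j) := uv; rewrite !mxE => <-; rewrite [RHS]addrC addKr.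
  by field.
have : \sum_j (u 0 j - x 0 j) ^+ 2 <= 0.
  under eq_bigr do rewrite E.
  rewrite sumrB -mulr_sumr big_split /=; lra.
rewrite le_eqVlt ltNge sumr_ge0 ?orbF => [|j _]; last exact: sqr_ge0.
rewrite psumr_eq0 => [/allP H|j _]; last exact: sqr_ge0.
apply/rowP => j; apply/eqP; have := H j (mem_index_enum _).
by rewrite /= sqrf_eq0 subr_eq0.
Qed.

Section Reduced.
Context {R : realType} {X : choiceType} {S : conical_complex R X}.
Context (K : fieldType) (M : monoidal_complex S).
Implicit Types f : toric_ring K M.

(* Among the exponents of [f] in a face [d], take [x] of maximal Euclidean norm:
   by strict convexity, [2x] arises in [f * f] only as [x + x]. *)
Lemma toric_sqr_eq0 f : f * f = 0 -> f = 0.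
Proof.
move=> ff; apply/eqP/negP => /negP f0.
have [x0 x0f] : exists x0, x0 \in monalg.msupp f.
  apply: contrapT => Nf; case/eqP: f0; apply/monalg.malgP => x.
  by rewrite monalg.mcoeff0 monalg.mcoeff_outdom//; apply/negP => xf; case: Nf; exists x.
have [d Sd [v0 Mv0 v0x]] := supportP x0.
have [sub _ _] := mon_faceP M Sd.
have dx0 : d (val x0) by rewrite -v0x; apply: chart_face => //; exact: sub.
pose N (x : msupport M) := \sum_j coord S d (val x) 0 j ^+ 2.
have [x [xf dx xM]] := seq_argmax N (P := fun x => d (val x)) x0f dx0.
have [z zE zU] := tmon_support K (add_in_support Sd dx dx (supportP x) (supportP x)).
have key y y' : y \in monalg.msupp f -> y' \in monalg.msupp f ->
    monalg.mcoeff z (tmon_mul K y y') = ((y == x) && (y' == x))%:R.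
  move=> yf y'f.
  have [[c [Sc cy cy']]|Nc] := pselect
      (exists c, [/\ faces S c, c (val y) & c (val y')]); last first.
    rewrite tmon_mul_eq0// monalg.mcoeff0; case: eqP => // yx; case: eqP => // y'x.
    by case: Nc; exists d; rewrite yx y'x.
  rewrite (tmon_mulE K Sc)//.
  have [z' z'E ->] := tmon_support K (add_in_support Sc cy cy' (supportP y) (supportP y')).
  rewrite monalg.mcoeffU -[RHS]mulr_natr mul1r; congr (_%:R); congr nat_of_bool.
  apply/eqP/andP => [zz|[/eqP yx /eqP y'x]]; last first.
    apply: val_inj; rewrite zE z'E yx y'x; apply: add_in_indep => //; by rewrite -?yx.
  have E : add_in S c (val y) (val y') = add_in S d (val x) (val x).
    by rewrite -zE -z'E zz.
  (* The double of [x] lies in [d], so by extremality [y] and [y'] do too, and norms can be compared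
     in the coordinates of [d]. *)
  have dxx : d (add_in S c (val y) (val y')) by rewrite E; exact: add_in_face.
  have dy : d (val y) := add_in_extremal Sc Sd cy cy' dxx.
  have dy' : d (val y').
    by apply: (add_in_extremal Sc Sd cy' cy); rewrite add_inC.
  have E2 : coord S d (val y) + coord S d (val y') = coord S d (val x) + coord S d (val x).
    by rewrite -!coord_add_in// -E (add_in_indep Sc Sd).
  have inj (p q : msupport M) : d (val p) -> d (val q) ->
      coord S d (val p) = coord S d (val q) -> p = q.
    move=> dp dq Epq; apply: val_inj.
    have [_ <-] := coord_spec Sd dp; have [_ <-] := coord_spec Sd dq.
    by rewrite Epq.
  split; apply/eqP; apply: inj => //; first exact: norm_midpoint E2 (xM _ yf dy) (xM _ y'f dy').
  by rewrite addrC in E2; exact: norm_midpoint E2 (xM _ y'f dy') (xM _ yf dy).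
have : monalg.mcoeff z (f * f) = monalg.mcoeff x f * monalg.mcoeff x f.
  have mD : {morph @monalg.mcoeff _ K z : p q / p + q} by move=> p q; exact: monalg.mcoeffD.
  rewrite (big_morph _ mD (monalg.mcoeff0 _)) (bigD1_seq x xf (fset_uniq _))/= addrC.
  rewrite big_seq_cond big1 ?add0r => [|y /andP[yf yx]]; last first.
    rewrite (big_morph _ mD (monalg.mcoeff0 _)) big_seq big1// => y' y'f.
    by rewrite monalg.mcoeffZ key// (negbTE yx) mulr0.
  rewrite (big_morph _ mD (monalg.mcoeff0 _)) (bigD1_seq x xf (fset_uniq _))/= addrC.
  rewrite big_seq_cond big1 ?add0r => [|y' /andP[y'f y'x]]; last first.
    by rewrite monalg.mcoeffZ key// (negbTE y'x) andbF mulr0.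
  by rewrite monalg.mcoeffZ key// eqxx mulr1.
rewrite ff monalg.mcoeff0 => /esym/eqP; rewrite mulf_eq0 orbb.
by rewrite monalg.mcoeff_eq0 xf.
Qed.

Lemma toric_reduced f k : f ^+ k = 0 -> f = 0.
Proof.
move=> fk; suff H j : f ^+ (2 ^ j) = 0 -> f = 0.
  (* Since $k<2^k$, also $f^{2^k}=0$, and repeated square roots remove the exponent. *)
  apply: (H k); rewrite -(subnK (ltnW (ltn_expl k (ltnSn 1)))) exprD fk.
  exact: mulr0.
elim: j => [|j IH]; first by rewrite expn0 expr1.
by rewrite expnSr exprM expr2 => /toric_sqr_eq0.
Qed.

End Reduced.

(** * Images of monomials in $K[\mathcal{M}_w]$ *)

Section WeightedMonomials.
Context {R : realType} {X : choiceType} {S : conical_complex R X}.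
Context (K : fieldType) (M : monoidal_complex S) {n : nat} (a : 'I_n -> X).
Hypothesis aM : forall e, msupport M (a e).
Variable w : 'I_n -> nat.
Local Notation D := (subdivision S a w).
Local Notation Mw := (weighted_complex M aM w).
Local Notation reducible := (reducible S a w).
Implicit Types (m : 'X_{1..n}) (c d : set X).

Lemma coord_integral c i : faces S c -> c (a i) -> integral (coord S c (a i)).
Proof.
move=> Sc ci; have [/(_ c Sc)[_ sub _ _] _] := monoidal_complexP M.
by apply: sub; exact: mon_coord.
Qed.

(** The chart of a face of $\Gamma_w$ is a linear map, given by [sc_inv], followed by the chart of
    one face of $\Sigma$. Hence addition in $\Gamma_w$ agrees with addition in $\Sigma$. *)
Lemma chart_subdiv d u v : faces D d -> cone D d u -> cone D d v ->
  exists c x y, [/\ faces S c, cone S c x, cone S c y, chart D d u = chart S c x &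
    chart D d v = chart S c y /\ chart D d (u + v) = chart S c (x + y)].
Proof.
move=> Dd Cu Cv; have kP := subdiv_chart_atP Dd; have [Sc _ _ _ _] := kP.
have [Fu _] := sc_invP kP Cu; have [Fv _] := sc_invP kP Cv.
exists (sc_face (subdiv_chart_at S a w d)).
exists (lsubmx (u *m sc_inv (subdiv_chart_at S a w d))).
exists (lsubmx (v *m sc_inv (subdiv_chart_at S a w d))).
split=> //; [exact: sc_lift_cone kP _ Fu|exact: sc_lift_cone kP _ Fv|split=> //].
by rewrite /= /sc_chart mulmxDl linearD.
Qed.

Lemma add_in_subdiv d c x y : faces D d -> faces S c -> d x -> d y -> c x -> c y ->
  add_in D d x y = add_in S c x y.
Proof.
move=> Dd Sc dx dy cx cy; rewrite {1}/add_in.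
have [Cu ux] := coord_spec Dd dx; have [Cv vy] := coord_spec Dd dy.
have [c' [u [v [Sc' Cu' Cv' Eu [Ev ->]]]]] := chart_subdiv Dd Cu Cv.
rewrite ux in Eu; rewrite vy in Ev.
rewrite -(coordK Sc' Cu') -(coordK Sc' Cv') -Eu -Ev.
by apply: add_in_indep => //; rewrite ?Eu ?Ev; exact: chart_face.
Qed.

Lemma chart0_subdiv d c : faces D d -> faces S c -> chart D d 0 = chart S c 0.
Proof.
move=> Dd Sc; have [Sc' _ _ _ _] := subdiv_chart_atP Dd.
by rewrite /= /sc_chart mul0mx linear0; exact: chart0_indep.
Qed.

Lemma ht_irreducible e : ht S a w (a e) = (w e)%:R -> ~ reducible U_(e)%MM.
Proof.
rewrite /ht; set c := min_face S (a e); set A := (X in minimum X) => htE.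
have [c0 Sc0 [v Mv ve]] := aM e.
have c0e : c0 (a e).
  by rewrite -ve; apply: chart_face => //; have [sub _ _] := mon_faceP M Sc0; exact: sub.
have [Sc ce _] := min_faceP Sc0 c0e.
have mE : msum S a c U_(e)%MM = coord S c (a e).
  rewrite /msum (bigD1 e)//= mnm1E eqxx big1 ?addr0// => i ie.
  by rewrite mnm1E eq_sym (negbTE ie).
have wE : wdeg w U_(e)%MM = w e.
  rewrite /wdeg (bigD1 e)//= mnm1E eqxx mul1n big1 ?addn0// => i ie.
  by rewrite mnm1E eq_sym (negbTE ie).
apply: (lbound_irreducible Sc).
  by move=> i; rewrite mnm1E; have [<-|//] := eqVneq e i.
rewrite mE wE -/A.
(* without a minimum, [ht] is the junk value [0], so that [w e = 0] *)
have [[h Ah]|N] := pselect (exists h, is_min A h).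
  by rewrite -htE (minimumE Ah); case: Ah.
move: htE; rewrite /minimum xgetPN => [<-|h Ah]; last by apply: N; exists h.
by move=> h /height_ge0; rewrite height_lift.
Qed.

(** All lifted generators lie in one bottom face, and so does their sum; thus the weight of [m] is
    the least height over its value. *)
Lemma irreducible_subdiv d m : faces D d -> supp_in a d m ->
  (forall i, m i != 0%N -> ht S a w (a i) = (w i)%:R) ->
  ~ reducible m /\ exists x, mval S a m x.
Proof.
move=> [c [F [Sc bF dE]]] sd hm; have [fF Fb] := bF.
have FE i : m i != 0%N -> F (lift_pt (coord S c (a i)) (w i)%:R) /\ c (a i).
  move=> mi; have := sd i mi; rewrite dE => -[_ [z Fz <-] zE].
  have Cz : cone S c (lsubmx z) by apply: lift_cone_proj => //; exact: face_sub fF _ Fz.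
  split; last by rewrite -zE; exact: chart_face.
  by rewrite -zE coordK// -hm// -zE -(bottom_ht Sc (Fb _ Fz)) lift_ptE.
have sc : supp_in a c m by move=> i /FE[].
split; last by exists (chart S c (msum S a c m)), c.
apply: (lbound_irreducible Sc sc).
have : F (lift_pt (msum S a c m) (wdeg w m)%:R).
  rewrite -sum_lift_pt (face_hull fF).
  apply: (big_ind (cone_hull _)) => [||i _]; [exact: cone_hull0|exact: cone_hullD|].
  have [->|mi] := eqVneq (m i) 0%N; first by rewrite mulr0n; exact: cone_hull0.
  have [Fi ci] := FE i mi; have [Ci Ei] := coord_spec Sc ci.
  rewrite -scaler_nat; apply: cone_hullZ => //; apply: sub_cone_hull; split=> //.
  by exists (coord S c (a i)), i.
move=> /Fb[v [h [E [_ lb]]]].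
have /esym := congr1 (fun x => lsubmx x) E; rewrite !lift_ptK => <-.
by have /esym := congr1 (fun x => height x) E; rewrite !height_lift => <-.
Qed.

Definition weighted_var e : toric_ring K Mw :=
  if ht S a w (a e) == (w e)%:R then tmon K Mw (a e) else 0.

(** The face [d] is the projection of the bottom face found by [irreducible_face]; as the lifted
    generators lie on the bottom, their weights are the heights. *)
Lemma irreducible_subdiv_face c m : faces S c -> supp_in a c m -> ~ reducible m ->
  exists2 d, faces D d & forall i, m i != 0%N -> [/\ d (a i),
    msupport Mw (a i), ht S a w (a i) = (w i)%:R & weighted_var i = tmon K Mw (a i)].
Proof.
move=> Sc sc rm.
have [F bF FE] := irreducible_face coord_integral Sc sc rm.
have Dd : faces D (proj_face S c F) by exists c, F.
exists (proj_face S c F) => // i mi.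
have [Ci Ei] := coord_spec Sc (sc i mi).
have di : proj_face S c F (a i).
  exists (coord S c (a i)) => //; exists (lift_pt (coord S c (a i)) (w i)%:R).
    exact: FE.
  exact: lift_ptK.
have hi : ht S a w (a i) = (w i)%:R.
  by have := bottom_ht Sc (bF.2 _ (FE i mi)); rewrite height_lift lift_ptK Ei => ->.
split=> //; last by rewrite /weighted_var hi eqxx.
have [Cu Eu] := coord_spec Dd di.
exists (proj_face S c F) => //; exists (coord D (proj_face S c F) (a i)) => //.
by apply: sub_monoid_hull; split=> //; exists i.
Qed.

Lemma weighted_prod m x : mval S a m x -> ~ reducible m ->
  msupport Mw x /\ \prod_(i < n) weighted_var i ^+ m i = tmon K Mw x.
Proof.
move=> [c Sc [sc ->]] rm.
have [d Dd H] := irreducible_subdiv_face Sc sc rm.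
have sd : supp_in a d m by move=> i /H[].
(* The product is computed in the face [d] of $\Gamma_w$, the value in the face [c] of $\Sigma$. *)
have [_ [_ <-]] := chart_msum_transfer Dd Sc (chart0_subdiv Dd Sc)
  (fun x y dx dy cx cy => add_in_subdiv Dd Sc dx dy cx cy) sd sc.
have [|Md ->] := @prod_tmon _ _ _ K Mw _ a weighted_var m d Dd.
  by move=> i /H[].
by split=> //; exact: mon_support.
Qed.

Lemma weighted_prod0 m : ~ (exists2 x, mval S a m x & ~ reducible m) ->
  \prod_(i < n) weighted_var i ^+ m i = 0.
Proof.
move=> N; apply/eqP; apply: contrapT => /negP P0; apply: N.
have hm i : m i != 0%N -> ht S a w (a i) = (w i)%:R.
  (* A variable of weight other than its height is sent to 0 and would kill the product. *)
  move=> mi; apply: contrapT => /eqP hi; case/eqP: P0.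
  rewrite (bigD1 i)//= /weighted_var (negbTE hi) expr0n (negbTE mi).
  exact: mul0r.
have [|d Dd sd] := prod_tmon_neq0 (M := Mw) (a := a) _ P0.
  move=> i mi.
  (* A variable whose weight is its height is irreducible as a monomial, so its point lies in
     $|\mathcal{M}_w|$. *)
  have [c Sc ci] : exists2 c, faces S c & c (a i).
    have [c Sc [v Mv <-]] := aM i; exists c => //; apply: chart_face => //.
    by have [sub _ _] := mon_faceP M Sc; exact: sub.
  have [|d _] := irreducible_subdiv_face Sc _ (ht_irreducible (hm i mi)).
    by move=> j; rewrite mnm1E; have [<-|//] := eqVneq i j.
  by move=> /(_ i); rewrite mnm1E eqxx => /(_ isT)[].
have [rm [x mx]] := irreducible_subdiv Dd sd hm.
by exists x.
Qed.

Lemma monomial_prod m x : mval S a m x ->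
  msupport M x /\ \prod_(i < n) tmon K M (a i) ^+ m i = tmon K M x.
Proof.
move=> [c Sc [sc ->]].
have [|Mc ->] := @prod_tmon _ _ _ K M _ a (fun i => tmon K M (a i)) m c Sc.
  by move=> i mi; split=> //; exact: sc.
by split=> //; exact: mon_support.
Qed.

Lemma monomial_prod0 m : ~ (exists x, mval S a m x) ->
  \prod_(i < n) tmon K M (a i) ^+ m i = 0.
Proof.
move=> N; apply/eqP; apply: contrapT => /negP P0; apply: N.
have [//|c Sc sc] := prod_tmon_neq0 (M := M) (a := a) _ P0.
by exists (chart S c (msum S a c m)), c.
Qed.

End WeightedMonomials.

(** * Radicals and homogeneous components of polynomials *)

Section Ideals.
Context {K : fieldType} {n : nat}.
Implicit Types (p q : {mpoly K[n]}) (A : set {mpoly K[n]}) (w : 'I_n -> nat).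

Lemma ideal_genD A p q : ideal_gen A p -> ideal_gen A q -> ideal_gen A (p + q).
Proof.
move=> [s sA ->] [t tA ->]; exists (s ++ t); last by rewrite big_cat.
by move=> x; rewrite mem_cat => /orP[/sA|/tA].
Qed.

Lemma ideal_genM A p q : ideal_gen A q -> ideal_gen A (p * q).
Proof.
move=> [s sA ->]; exists [seq (p * x.1, x.2) | x <- s].
  by move=> x /mapP[y /sA yA ->].
by rewrite big_map mulr_sumr; apply: eq_bigr => x _; rewrite mulrA.
Qed.

Lemma ideal_gen0 A : ideal_gen A 0.
Proof. by exists [::] => //; rewrite big_nil. Qed.

Lemma sub_ideal_gen A : A `<=` ideal_gen A.
Proof.
by move=> p Ap; exists [:: (1, p)] => [x|]; rewrite ?inE ?big_seq1 ?mul1r// => /eqP->.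
Qed.

Lemma sub_radical A : A `<=` radical A.
Proof. by move=> p Ap; exists 1%N; rewrite expr1. Qed.

Lemma radicalM A p q : radical (ideal_gen A) q -> radical (ideal_gen A) (p * q).
Proof. by move=> [k qk]; exists k; rewrite exprMn; exact: ideal_genM. Qed.

Lemma radicalD A p q : radical (ideal_gen A) p -> radical (ideal_gen A) q ->
  radical (ideal_gen A) (p + q).
Proof.
move=> [j pj] [k qk]; exists (j + k)%N; rewrite exprDn.
apply: (big_ind (ideal_gen A)) => [||i _]; [exact: ideal_gen0|exact: ideal_genD|].
rewrite -mulr_natl; apply: ideal_genM.
have [ki|ik] := leqP k i.
  by rewrite -(subnK ki) exprD mulrA; exact: ideal_genM.
have ji : (j <= j + k - i)%N by rewrite -addnBA ?leq_addr// ltnW.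
by rewrite -(subnK ji) exprD mulrAC; exact: ideal_genM.
Qed.

(** The bound [k] need not be attained: the component of degree [k] is the initial component if it
    is, and 0 otherwise. *)
Lemma initial_ideal_pihomog w A p k : A p ->
  (forall m, m \in msupp p -> (wdeg w m <= k)%N) ->
  initial_ideal w A (pihomog (wdeg w) k p).
Proof.
move=> Ap pk; have [/hasP[m mp /eqP mk]|/hasPn N] := boolP (has (fun m => wdeg w m == k) (msupp p)).
  apply: sub_ideal_gen; exists p => //; rewrite /initial_form; congr (pihomog _ _ p).
  apply/eqP; rewrite eqn_leq; apply/andP; split.
    by apply/bigmax_leqP_seq => m' m'p _; exact: pk.
  by rewrite -mk; exact: leq_bigmax_seq.
rewrite pihomogE big_seq_cond big1; first exact: ideal_gen0.
by move=> m /andP[/N/negbTE->].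
Qed.

Lemma wdeg_mul w m k : wdeg w (m *+ k)%MM = (k * wdeg w m)%N.
Proof.
rewrite /wdeg big_distrr /=; apply: eq_bigr => i _.
by rewrite mulmnE [(m i * k)%N]mulnC mulnA.
Qed.

End Ideals.

(** * Linear maps out of a toric face ring *)

Section Evaluation.
Context {R : realType} {X : choiceType} {S : conical_complex R X}.
Context (K : fieldType) (M : monoidal_complex S) {n : nat}.
Implicit Types (t : 'I_n -> toric_ring K M) (p q : {mpoly K[n]}).

Lemma toric_evalD t p q : toric_eval t (p + q) = toric_eval t p + toric_eval t q.
Proof. by rewrite -[p]scale1r toric_eval_linear !scale1r. Qed.

Lemma toric_evalZ t k p : toric_eval t (k *: p) = k *: toric_eval t p.
Proof. by rewrite -[k *: p]addr0 toric_eval_linear toric_eval0 addr0. Qed.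

Lemma toric_evalB t p q : toric_eval t (p - q) = toric_eval t p - toric_eval t q.
Proof. by rewrite toric_evalD -scaleN1r toric_evalZ scaleN1r. Qed.

Lemma toric_eval_exp t p k : toric_eval t (p ^+ k) = toric_eval t p ^+ k.
Proof.
elim: k => [|k IH]; first by rewrite !expr0 toric_eval1.
by rewrite !exprS toric_evalM IH.
Qed.

Definition tmon_ext {V : lmodType K} (h : X -> V) (f : toric_ring K M) : V :=
  malg_ext (fun x : msupport M => h (val x)) f.

Lemma tmon_ext_tmon {V : lmodType K} (h : X -> V) x : msupport M x ->
  tmon_ext h (tmon K M x) = h x.
Proof.
by move=> /(tmon_support K)[y <- ->]; rewrite /tmon_ext malg_extU.
Qed.

Lemma tmon_ext0 {V : lmodType K} (h : X -> V) : tmon_ext h 0 = 0.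
Proof. exact: malg_ext0. Qed.

Lemma tmon_ext_eval {V : lmodType K} (h : X -> V) t p :
  tmon_ext h (toric_eval t p) =
  \sum_(m <- msupp p) p@_m *: tmon_ext h (\prod_(i < n) t i ^+ m i).
Proof.
rewrite /toric_eval; elim/big_rec2: _ => [|m f g _ <-]; first exact: malg_ext0.
by rewrite /tmon_ext [LHS]malg_extD malg_extZ.
Qed.

End Evaluation.

(** * The two inclusions *)

Section InitialIdeal.
Context {R : realType} {X : choiceType} {S : conical_complex R X}.
Context (K : fieldType) (M : monoidal_complex S) {n : nat} (a : 'I_n -> X).
Hypothesis aM : forall e, msupport M (a e).
Variable w : 'I_n -> nat.
Local Notation D := (subdivision S a w).
Local Notation Mw := (weighted_complex M aM w).
Local Notation reducible := (reducible S a w).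
Local Notation mval := (mval S a).
Local Notation I := (toric_ideal K M a).
Local Notation J := (weighted_ideal K M aM w).
Implicit Types (m : 'X_{1..n}) (p : {mpoly K[n]}).

Lemma weighted_idealE p : J p = (toric_eval (weighted_var K aM w) p = 0).
Proof. by []. Qed.

Lemma initial_form_weighted p : I p -> J (initial_form w p).
Proof.
rewrite weighted_idealE => Ip; rewrite /initial_form.
set k := \max_(m <- _) _.
pose h x : toric_ring K Mw :=
  if `[< exists m, [/\ mval m x, ~ reducible m & wdeg w m = k] >]
  then tmon K Mw x else 0.
have := congr1 (tmon_ext h) Ip; rewrite tmon_ext0 tmon_ext_eval => <-.
rewrite pihomogE big_mkcond [LHS](big_morph _ (toric_evalD _) (toric_eval0 _)) /=.
rewrite big_seq [RHS]big_seq; apply: eq_bigr => m mp.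
have mk : (wdeg w m <= k)%N by exact: leq_bigmax_seq.
have -> : toric_eval (weighted_var K aM w) (if wdeg w m == k then p@_m *: 'X_[m] else 0) =
    p@_m *: (if wdeg w m == k then \prod_(i < n) weighted_var K aM w i ^+ m i else 0).
  case: ifP => _; last by rewrite toric_eval0 scaler0.
  by rewrite toric_evalZ toric_evalXm.
congr (_ *: _); have [[x mx]|N] := pselect (exists x, mval m x); last first.
  rewrite monomial_prod0// tmon_ext0 weighted_prod0; first by case: ifP.
  by move=> [x mx _]; apply: N; exists x.
have [Mx ->] := monomial_prod K aM mx; rewrite tmon_ext_tmon// /h.
(* If an irreducible [m'] of weight [k] has value [x], minimality and the bound [mk] give [m] weight
   [k], and [m] is irreducible too. Otherwise [m] is reducible or has weight below [k], and both
   sides are 0. *)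
case: asboolP => [[m' [m'x rm' m'k]]|N].
  have E : wdeg w m = k.
    by apply/eqP; rewrite eqn_leq mk -m'k; exact: irreducible_min rm' m'x mx.
  rewrite E eqxx; have [||_ ->//] := @weighted_prod _ _ _ K _ _ _ aM w m x => //.
  by move=> rm; apply: rm'; apply: reducible_mval mx m'x _ rm; rewrite E.
case: eqP => // E; apply: weighted_prod0 => -[y my rm]; apply: N.
by exists m; split=> //; rewrite (mval_inj mx my).
Qed.

Lemma weighted_sub_radical : J `<=` radical (initial_ideal w I).
Proof.
move=> p Jp; rewrite weighted_idealE in Jp.
pose rep x := xget 0%MM [set m | mval m x /\ ~ reducible m].
pose h x : {mpoly K[n]} := 'X_[rep x].
pose L m := tmon_ext h (\prod_(i < n) weighted_var K aM w i ^+ m i).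
(* The subtracted terms add up to the image of [toric_eval (weighted_var K aM w) p], which is 0. *)
have -> : p = \sum_(m <- msupp p) (p@_m)%:MP * ('X_[m] - L m).
  under eq_bigr do rewrite mul_mpolyC scalerBr.
  rewrite sumrB -mpolyE -(tmon_ext_eval h) Jp tmon_ext0.
  exact/esym/subr0.
have Isub m m' x : mval m x -> mval m' x -> I ('X_[m] - 'X_[m']).
  move=> mx m'x; rewrite /toric_ideal /= toric_evalB !toric_evalXm.
  by rewrite (monomial_prod K aM mx).2 (monomial_prod K aM m'x).2 subrr.
have wsub m m' : (wdeg w m' <= wdeg w m)%N ->
    forall m1, m1 \in msupp ('X_[m] - 'X_[m'] : {mpoly K[n]}) -> (wdeg w m1 <= wdeg w m)%N.
  move=> le m1 /msuppB_le; rewrite mem_cat !msuppX !inE.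
  by move=> /orP[/eqP->|/eqP->].
apply: (big_ind (radical _)) => [||m _].
- by apply: sub_radical; exact: ideal_gen0.
- exact: radicalD.
apply: radicalM.
have [[x mx rm]|N] := pselect (exists2 x, mval m x & ~ reducible m).
  rewrite /L; have [Mx ->] := weighted_prod K aM mx rm.
  rewrite tmon_ext_tmon// /h.
  have [repx rrep] : mval (rep x) x /\ ~ reducible (rep x).
    have : exists m, mval m x /\ ~ reducible m by exists m.
    by move=> /(xgetPex 0%MM).
  (* Irreducible monomials of one value both have minimal weight, so the binomial is homogeneous and
     is its own initial component. *)
  have E : wdeg w m = wdeg w (rep x).
    apply/eqP; rewrite eqn_leq; apply/andP; split.
      exact: irreducible_min rm mx repx.
    exact: irreducible_min rrep repx mx.
  apply: sub_radical.
  rewrite (_ : _ - _ = pihomog (wdeg w) (wdeg w m) ('X_[m] - 'X_[rep x])).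
    apply: initial_ideal_pihomog; first exact: Isub mx repx.
    by apply: wsub; rewrite E.
  by rewrite pihomogB !pihomogX /= eqxx -E eqxx.
rewrite /L weighted_prod0// tmon_ext0 subr0.
(* A monomial without a value lies in $I_{\mathcal{M}}$ itself; for a reducible one, some power is
   the initial component of a binomial. *)
have [[x mx]|Nx] := pselect (exists x, mval m x); last first.
  apply: sub_radical.
  have -> : 'X_[m] = pihomog (wdeg w) (wdeg w m) 'X_[m] :> {mpoly K[n]}.
    by rewrite pihomogX eqxx.
  apply: initial_ideal_pihomog; last by move=> m'; rewrite msuppX inE => /eqP->.
  by rewrite /toric_ideal /= toric_evalXm; exact: monomial_prod0.
have [k [m' [y [my m'y lt]]]] : reducible m.
  by apply: contrapT => rm; apply: N; exists x.
exists k; rewrite mpolyXn.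
have -> : 'X_[m *+ k] =
    pihomog (wdeg w) (wdeg w (m *+ k)%MM) ('X_[m *+ k] - 'X_[m']) :> {mpoly K[n]}.
  by rewrite pihomogB !pihomogX eqxx wdeg_mul (ltn_eqF lt) subr0.
apply: initial_ideal_pihomog; first exact: Isub my m'y.
by apply: wsub; rewrite wdeg_mul ltnW.
Qed.

Lemma radical_sub_weighted : radical (initial_ideal w I) `<=` J.
Proof.
(* Reducedness of $K[\mathcal{M}_w]$ reduces the claim to $p^k$, a combination of initial
   components. *)
move=> p [k [s sI pk]]; rewrite weighted_idealE; apply: (@toric_reduced _ _ _ _ _ _ k).
rewrite -toric_eval_exp pk (big_morph _ (toric_evalD _) (toric_eval0 _)).
rewrite big_seq big1// => x /sI[f If <-].
by rewrite toric_evalM initial_form_weighted// mulr0.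
Qed.

End InitialIdeal.

Theorem theorem3p4 (R : realType) (K : fieldType) (X : choiceType)
    (Sigma : conical_complex R X) (M : monoidal_complex Sigma)
    (n : nat) (a : 'I_n -> X) (aM : forall e : 'I_n, msupport M (a e))
    (agen : forall c : set X, faces Sigma c ->
      monoid_hull (M c `&` [set v | exists e : 'I_n, chart Sigma c v = a e]) =
      M c)
    (w : 'I_n -> nat) :
  weighted_ideal K M aM w = radical (initial_ideal w (toric_ideal K M a)).
Proof.
by apply/seteqP; split; [exact: weighted_sub_radical|exact: radical_sub_weighted].
Qed.
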